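(* Consider $N$ Euler–Lagrange systems $$M_i(q_i)\ddot q_i+C_i(q_i,\dot q_i)\dot q_i+G_i(q_i)=\tau_i,\quad i=1,\dots,N,$$ with $q_i,\tau_i\in\mathbb{R}^n$, satisfying: (P1) $M_i(q_i)$ is symmetric and uniformly positive definite; (P2) for all $a',b\in\mathbb{R}^n$, $M_i(q_i)a'+C_i(q_i,\dot q_i)b+G_i(q_i)=Y_i(q_i,\dot q_i,a',b)\Theta_i$ with $Y_i$ a known regression matrix and $\Theta_i\in\mathbb{R}^p$ an unknown constant vector; (P3) $\dot M_i(q_i)-2C_i(q_i,\dot q_i)$ is skew-symmetric for all $q_i,\dot q_i$. Let $l$ be a positive integer, $m=2l$, $a=\begin{bmatrix}0&1\\-1&0\end{bmatrix}$, $S(z)=\mathrm{diag}(z)\otimes a$ for $z\in\mathbb{R}^l$, and let the leader be $\dot v=S(\omega)v$, $q_0=Cv$, where $v\in\mathbb{R}^m$, $C\in\mathbb{R}^{n\times m}$ is known, and $\omega=\mathrm{col}(\omega_{01},\dots,\omega_{0l})\in\mathbb{R}^l$ is an unknown vector with $\omega_{0k}>0$ for all $k$. Let $\bar{\mathcal G}$ be a digraph on nodes $\{0,1,\dots,N\}$ (node $0$ the leader, node $i$ the $i$-th Euler–Lagrange system) that contains a spanning tree rooted at node $0$, and such that the subgraph $\mathcal G$ on $\{1,\dots,N\}$ (obtained by removing all edges between node $0$ and the other nodes) is undirected; let $\bar{\mathcal N}_i=\{j:(j,i)\text{ is an edge of }\bar{\mathcal G}\}$. Consider the control law, for $i=1,\dots,N$,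 $$\tau_i=-K_is_i+Y_i\hat\Theta_i,\quad \dot{\hat\Theta}_i=-\Lambda_i^{-1}Y_i^Ts_i,$$ $$\dot\eta_i=S(\omega_i)\eta_i+\mu_1e_{vi},\quad \dot\omega_i=\mu_2\phi(e_{vi})\eta_i,\quad e_{vi}=\sum_{j\in\bar{\mathcal N}_i}(\eta_j-\eta_i),\ \eta_0=v,$$ where $\dot q_{ri}=CS(\omega_i)\eta_i-\alpha(q_i-C\eta_i)$, $s_i=\dot q_i-\dot q_{ri}$, $\ddot q_{ri}=CS(\omega_i)\dot\eta_i+CS(\dot\omega_i)\eta_i-\alpha(\dot q_i-C\dot\eta_i)$, $Y_i=Y_i(q_i,\dot q_i,\ddot q_{ri},\dot q_{ri})$ is the regression matrix from (P2) so that $Y_i\Theta_i=M_i(q_i)\ddot q_{ri}+C_i(q_i,\dot q_i)\dot q_{ri}+G_i(q_i)$, $\alpha>0$, $\mu_1,\mu_2>0$, $K_i$ are positive definite matrices, $\Lambda_i$ are diagonal matrices with positive diagonal entries, and for $x\in\mathbb{R}^m$, $\phi(x)\in\mathbb{R}^{l\times m}$ has $k$-th row with entry $-x_{2k}$ in column $2k-1$, $x_{2k-1}$ in column $2k$, and zeros elsewhere. Then for any initial conditions $q_i(0),\dot q_i(0),v(0),\eta_i(0),\omega_i(0),\hat\Theta_i(0)$, the closed-loop trajectories $q_i(t),\dot q_i(t),\eta_i(t),\omega_i(t),\hat\Theta_i(t)$ exist and are bounded for all $t\ge0$, and for $i=1,\dots,N$, $$\lim_{t\to\infty}(q_i(t)-q_0(t))=0,\qquad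 \lim_{t\to\infty}(\dot q_i(t)-\dot q_0(t))=0.$$
   Context: $\otimes$ is the Kronecker product; $\mathrm{col}(\cdot)$ stacks vectors into a column. The matrix $S(\omega)$ of the leader is skew-symmetric with all eigenvalues semi-simple and on the imaginary axis; the vector $\omega$ is not known to any follower and is not used by the control law.
   Formalization: Regularity left implicit is assumed: each M_i is differentiable and C_i, G_i, Y_i are jointly continuous in their arguments (for discontinuous G_i trajectories need not exist); the positive definite K_i are taken to be symmetric. *)

(* Defs.v *)
From HB Require Import structures.
From mathcomp Require Import all_boot all_order all_algebra.
From mathcomp Require Import all_classical all_reals all_analysis.
Set Implicit Arguments.
Unset Strict Implicit.
Unset Printing Implicit Defensive.
Import Order.TTheory GRing.Theory Num.Theory.
Import numFieldNormedType.Exports.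
Local Open Scope classical_set_scope.
Local Open Scope ring_scope.

(* Kronecker product A (x) B, with the standard (row-major) index convention:
   row index (i,k) of 'I_(m1*m2) is mxvec_index i k, i.e. i*m2 + k. *)
Definition kron (R : pzRingType) m1 n1 m2 n2 (A : 'M[R]_(m1, n1)) (B : 'M[R]_(m2, n2))
  : 'M[R]_(m1 * m2, n1 * n2) :=
  \matrix_(r, c) \sum_(i < m1) \sum_(k < m2) \sum_(j < n1) \sum_(h < n2)
     ((r == mxvec_index i k) && (c == mxvec_index j h))%:R * (A i j * B k h).

Definition i0_2 : 'I_2 := ord0.
Definition i1_2 : 'I_2 := ord_max.

Definition amat (R : pzRingType) : 'M[R]_2 :=
  \matrix_(i, j) (if (i == i0_2) && (j == i1_2) then 1
                  else if (i == i1_2) && (j == i0_2) then -1 else 0).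

Definition Smat (R : pzRingType) l (z : 'cV[R]_l) : 'M[R]_(l * 2) :=
  kron (diag_mx z^T) (amat R).

(* phi(x) in R^{l x m}: row k has -x_{2k} in column 2k-1, x_{2k-1} in column 2k
   (1-based); in 0-based Kronecker indexing, component 2k-1 (1-based) of x is
   x (mxvec_index k 0) and component 2k is x (mxvec_index k 1). *)
Definition phi (R : pzRingType) l (x : 'cV[R]_(l * 2)) : 'M[R]_(l, l * 2) :=
  \matrix_(k, c) ((c == mxvec_index k i0_2)%:R * - x (mxvec_index k i1_2) ord0
                 + (c == mxvec_index k i1_2)%:R * x (mxvec_index k i0_2) ord0).

(* A digraph on 'I_N.+1 is a relation E with  E j i  meaning (j,i) is an edge.
   It contains a spanning tree rooted at r: a sub-relation T of E in which the
   root has no incoming edge, every other node exactly one, and every node is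
   reachable from r along T. *)
Definition has_spanning_tree (N : nat) (E : rel 'I_N.+1) (r : 'I_N.+1) : Prop :=
  exists T : rel 'I_N.+1,
    (forall i j, T i j -> E i j) /\
    #|[set j | T j r]| = 0%N /\
    (forall i, i != r -> #|[set j | T j i]| = 1%N) /\
    (forall i, connect T r i).

Definition nodeval (X : Type) (N : nat) (v : X) (eta : 'I_N -> X) (j : 'I_N.+1) : X :=
  if unlift ord0 j is Some i then eta i else v.

Definition posdef (R : numDomainType) n (A : 'M[R]_n) : Prop :=
  A^T = A /\ forall x : 'cV[R]_n, x != 0 -> 0 < (x^T *m A *m x) ord0 ord0.

Definition bounded_pos (R : realType) a b (x : R -> 'M[R]_(a, b)) : Prop :=
  exists B : R, forall t, 0 <= t -> `|x t| <= B.

(* The closed-loop system (leader + N Euler-Lagrange followers + controller):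
   a solution on [0, +oo) is continuous from the right at 0 and satisfies the
   differential equations for every t > 0. *)
Definition closed_loop (R : realType) (N n p l : nat)
  (M : 'I_N -> 'cV[R]_n -> 'M[R]_n)
  (Cm : 'I_N -> 'cV[R]_n -> 'cV[R]_n -> 'M[R]_n)
  (G : 'I_N -> 'cV[R]_n -> 'cV[R]_n)
  (Y : 'I_N -> 'cV[R]_n -> 'cV[R]_n -> 'cV[R]_n -> 'cV[R]_n -> 'M[R]_(n, p))
  (Cout : 'M[R]_(n, l * 2)) (om0 : 'cV[R]_l) (E : rel 'I_N.+1)
  (alpha mu1 mu2 : R) (K : 'I_N -> 'M[R]_n) (Lam : 'I_N -> 'M[R]_p)
  (v : R -> 'cV[R]_(l * 2))
  (q qd : 'I_N -> R -> 'cV[R]_n)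
  (eta : 'I_N -> R -> 'cV[R]_(l * 2))
  (om : 'I_N -> R -> 'cV[R]_l)
  (th : 'I_N -> R -> 'cV[R]_p) : Prop :=
  (v t @[t --> 0^'+] --> v 0) /\
  (forall i, [/\ q i t @[t --> 0^'+] --> q i 0, qd i t @[t --> 0^'+] --> qd i 0,
     eta i t @[t --> 0^'+] --> eta i 0, om i t @[t --> 0^'+] --> om i 0
     & th i t @[t --> 0^'+] --> th i 0]) /\
  forall t : R, 0 < t ->
    is_derive t 1 v (Smat om0 *m v t) /\
    forall i : 'I_N,
      let ev := \sum_(j < N.+1 | E j (lift ord0 i))
                   (nodeval (v t) (fun k => eta k t) j - eta i t) in
      let etad := Smat (om i t) *m eta i t + mu1 *: ev in
      let omd := mu2 *: (phi ev *m eta i t) in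
      let qdr := Cout *m Smat (om i t) *m eta i t - alpha *: (q i t - Cout *m eta i t) in
      let s := qd i t - qdr in
      let qddr := Cout *m Smat (om i t) *m etad + Cout *m Smat omd *m eta i t
                  - alpha *: (qd i t - Cout *m etad) in
      let Yi := Y i (q i t) (qd i t) qddr qdr in
      let tau := - (K i *m s) + Yi *m th i t in
      [/\ is_derive t 1 (q i) (qd i t),
          (exists acc : 'cV[R]_n, is_derive t 1 (qd i) acc /\
             M i (q i t) *m acc + Cm i (q i t) (qd i t) *m qd i t + G i (q i t) = tau),
          is_derive t 1 (eta i) etad,
          is_derive t 1 (om i) omd
        & is_derive t 1 (th i) (- (invmx (Lam i) *m (Yi^T *m s)))].

(* Main.v *)
(** Combine the leader with the N followers in one autonomous system [x' = field x] and
    consider [U = bet V + sum_i (|e_i|^2 / 2 + gam_i W_i)], where [e_i = q_i - C eta_i],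
    [V] is the graph energy of [(v, eta)] plus [sum_i |om_i - om0|^2 / (2 mu2)], and [W_i]
    is the usual Slotine-Li function of [s_i] and of the parameter error.  Then
    [V' = - mu1 sum_i |ev_i|^2], [W_i' = - s_i^T K_i s_i] and
    [e_i' = s_i - alpha e_i - mu1 C ev_i], so for suitable weights
    [U' <= - sum_i (alpha / 2 |e_i|^2 + |s_i|^2 + |ev_i|^2)], and the sublevel sets of
    [(U, |v|^2)] are bounded.
    Existence: the field is only continuous, so solutions come from Peano's theorem (an
    ultrafilter limit of Euler schemes) for a cut-off field [chi x *: field x]; the factor
    [chi >= 0] only rescales time, so the Lyapunov bound holds with the same constant and
    [chi = 1] along the solution.
    Convergence: Barbalat's lemma applied to [U] gives [e_i, s_i, ev_i -> 0]; since
    [sum_i ev_i . (eta_i - v)] is minus twice the graph energy, [eta_i - v -> 0] along the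
    spanning tree, and Barbalat's lemma applied to [eta_i - v] gives
    [S(om_i) eta_i - S(om0) v -> 0].  Both limits follow, without [om_i -> om0]. *)

Require Import Defs.
From HB Require Import structures.
From mathcomp Require Import all_boot all_order all_algebra.
From mathcomp Require Import all_classical all_reals all_analysis.
From mathcomp Require Import ring lra.
Set Implicit Arguments.
Unset Strict Implicit.
Unset Printing Implicit Defensive.
Import Order.TTheory GRing.Theory Num.Theory.
Import numFieldNormedType.Exports.
Local Open Scope classical_set_scope.
Local Open Scope ring_scope.

(** * Limits and derivatives of matrix functions *)

Section matrix_limits.
Context {R : realType}.

(** A cascade argument, with the observers settled before the tracking errors, presupposes a
    solution on the whole half-line. Here solutions are not known to last, nor to be unique, so a
    single function must bound all components at once, before existence. This is why [|e_i|^2 / 2]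
    joins the usual terms and why the weights matter: the cross terms of [e_i . e_i'] have to be
    dominated by the dissipation of the others. [U] sees only the differences [eta_i - v]; [|v|^2],
    constant because [S(om0)] is skew, is carried along for that reason. The frequency adaptation
    enters through one identity: [phi e *m y] is the gradient in [w] of [e . S(w) y], so the
    frequency error cancels exactly from [V']. Nothing then fixes the limit of [om_i], and the
    velocity limit has to go through the derivative of [eta_i - v]. Without uniqueness, existence
    and the properties of an arbitrary solution are separate statements. Barbalat's hypothesis is
    cheap: a bounded solution is Lipschitz, and the derivatives concerned are continuous functions
    of the state. *)

Lemma mx_norm_leP m n (A : 'M[R]_(m, n)) (r : R) :
  `|A| <= r <-> 0 <= r /\ forall i j, `|A i j| <= r.
Proof.
rewrite [`|A|]/Num.Def.normr/= mx_normrE; split.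
  (* The maximum over no index is 0, so [0 <= r] is a separate condition for matrices without
     entries. *)
  move=> h; split; first by apply: le_trans h; exact: bigmax_ge_id.
  by move=> i j; apply: le_trans h; exact: (le_bigmax _ (fun ij => `|A ij.1 ij.2|) (i, j)).
by move=> [r0 h]; apply: bigmax_le => // -[i j] _; exact: h.
Qed.

Lemma ler_mx_entry m n (A : 'M[R]_(m, n)) i j : `|A i j| <= `|A|.
Proof. by have [_] := (mx_norm_leP A `|A|).1 (lexx _); apply. Qed.

Lemma cvg_mxP (T : Type) (F : set_system T) {FF : Filter F} m n
    (A : T -> 'M[R]_(m, n)) (l : 'M[R]_(m, n)) :
  A x @[x --> F] --> l <-> forall i j, A x i j @[x --> F] --> l i j.
Proof.
split=> [Al i j|Al].
  exact: (cvg_comp A (fun M : 'M[R]_(m, n) => M i j) Al (@coord_continuous R m n i j l)).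
apply/cvgrPdist_le => e e0.
have : \forall x \near F, forall ij : 'I_m * 'I_n, `|l ij.1 ij.2 - A x ij.1 ij.2| <= e.
  by apply: filter_forall => -[i j]; exact: ((cvgrPdist_le _ _).1 (Al i j)).
apply: filterS => x h; apply/mx_norm_leP; split; first exact: ltW.
by move=> i j; rewrite !mxE; exact: (h (i, j)).
Qed.

Lemma continuous_mx (T : topologicalType) m n (A : T -> 'M[R]_(m, n)) :
  (forall i j, continuous (fun x => A x i j)) -> continuous A.
Proof. by move=> h x; apply: (cvg_mxP _ _).2 => i j; exact: h. Qed.

Lemma cvg_sumr (T : Type) (F : set_system T) {FF : Filter F} (I : finType) (P : pred I)
    (V : normedModType R) (f : I -> T -> V) (l : I -> V) :
  (forall i, f i x @[x --> F] --> l i) ->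
  \sum_(i | P i) f i x @[x --> F] --> \sum_(i | P i) l i.
Proof.
by move=> fl; apply: (cvg_big (op := +%R)) => //; exact: add_continuous.
Qed.

Lemma cvg_prodr (T : Type) (F : set_system T) {FF : Filter F} (I : finType) (P : pred I)
    (f : I -> T -> R) (l : I -> R) :
  (forall i, f i x @[x --> F] --> l i) ->
  \prod_(i | P i) f i x @[x --> F] --> \prod_(i | P i) l i.
Proof.
by move=> fl; apply: (@cvg_big R I *%R 1 P) => //; exact: (@mul_continuous R).
Qed.

Lemma cvg_mulmx (T : Type) (F : set_system T) {FF : Filter F} m n k
    (A : T -> 'M[R]_(m, n)) (B : T -> 'M[R]_(n, k)) (a : 'M[R]_(m, n)) (b : 'M[R]_(n, k)) :
  A x @[x --> F] --> a -> B x @[x --> F] --> b ->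
  A x *m B x @[x --> F] --> a *m b.
Proof.
move=> /cvg_mxP Aa /cvg_mxP Bb; apply/cvg_mxP => i j.
under eq_fun do rewrite mxE; rewrite mxE.
by apply: cvg_sumr => h; apply: cvgM; [exact: Aa|exact: Bb].
Qed.

Lemma cvg_trmx (T : Type) (F : set_system T) {FF : Filter F} m n
    (A : T -> 'M[R]_(m, n)) (a : 'M[R]_(m, n)) :
  A x @[x --> F] --> a -> (A x)^T @[x --> F] --> a^T.
Proof.
move=> /cvg_mxP Aa; apply/cvg_mxP => i j.
by under eq_fun do rewrite mxE; rewrite mxE; exact: Aa.
Qed.

Lemma cvg_det (T : Type) (F : set_system T) {FF : Filter F} n
    (A : T -> 'M[R]_n) (a : 'M[R]_n) :
  A x @[x --> F] --> a -> \det (A x) @[x --> F] --> \det a.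
Proof.
move=> /cvg_mxP Aa; apply: cvg_sumr => s.
apply: cvgM; first exact: cvg_cst.
by apply: cvg_prodr => i; exact: Aa.
Qed.

Lemma cvg_adjugate (T : Type) (F : set_system T) {FF : Filter F} n
    (A : T -> 'M[R]_n) (a : 'M[R]_n) :
  A x @[x --> F] --> a -> \adj (A x) @[x --> F] --> \adj a.
Proof.
move=> Aa; apply/cvg_mxP => i j; under eq_fun do rewrite mxE; rewrite mxE.
apply: cvgM; first exact: cvg_cst.
apply: cvg_det; apply/cvg_mxP => i' j'; under eq_fun do rewrite !mxE; rewrite !mxE.
by move/cvg_mxP : Aa; exact.
Qed.

(** [invmx] is adjugate over determinant on units and the identity map elsewhere; invertibility at
    every [x] keeps to the first branch. *)
Lemma cvg_invmx (T : Type) (F : set_system T) {FF : Filter F} n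
    (A : T -> 'M[R]_n) (a : 'M[R]_n) :
  (forall x, A x \in unitmx) -> a \in unitmx ->
  A x @[x --> F] --> a -> invmx (A x) @[x --> F] --> invmx a.
Proof.
move=> Au au Aa; rewrite /invmx au; under eq_fun do rewrite Au.
apply: cvgZ; last exact: cvg_adjugate.
by apply: cvgV; [rewrite -unitfE -unitmxE|exact: cvg_det].
Qed.

End matrix_limits.

Section matrix_derivatives.
Context {R : realType}.

Lemma is_derive_cvg (V W : normedModType R) (f : V -> W) a v l :
  h^-1 *: (f (h *: v + a) - f a) @[h --> 0^'] --> l -> is_derive a v f l.
Proof.
move=> fl; apply: DeriveDef; first by apply/cvg_ex; exists l.
exact: cvg_lim fl.
Qed.

Lemma cvg_is_derive (V W : normedModType R) (f : V -> W) a v l :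
  is_derive a v f l -> h^-1 *: (f (h *: v + a) - f a) @[h --> 0^'] --> l.
Proof. by move=> [df <-]. Qed.

Lemma is_derive_mxP m n (A : R -> 'M[R]_(m, n)) (t : R) (dA : 'M[R]_(m, n)) :
  is_derive t 1 A dA <-> forall i j, is_derive t 1 (fun s => A s i j) (dA i j).
Proof.
split=> [/cvg_is_derive/cvg_mxP h i j|h].
  apply: is_derive_cvg; have := h i j.
  by under eq_fun do rewrite !mxE.
apply: is_derive_cvg; apply/cvg_mxP => i j; under eq_fun do rewrite !mxE.
exact: (cvg_is_derive (h i j)).
Qed.

Lemma is_derive_pair (V W : normedModType R) (f : R -> V) (g : R -> W) (t : R) df dg :
  is_derive t 1 f df -> is_derive t 1 g dg -> is_derive t 1 (fun s => (f s, g s)) (df, dg).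
Proof.
move=> /cvg_is_derive hf /cvg_is_derive hg; apply: is_derive_cvg.
exact: cvg_pair hf hg.
Qed.

Lemma is_derive_fst (V W : normedModType R) (f : R -> V * W) (t : R) df :
  is_derive t 1 f df -> is_derive t 1 (fun s => (f s).1) df.1.
Proof.
move=> /cvg_is_derive hf; apply: is_derive_cvg.
exact: (cvg_comp _ (@fst V W) hf (@cvg_fst _ _ (nbhs df.1) (nbhs df.2) _)).
Qed.

Lemma is_derive_snd (V W : normedModType R) (f : R -> V * W) (t : R) df :
  is_derive t 1 f df -> is_derive t 1 (fun s => (f s).2) df.2.
Proof.
move=> /cvg_is_derive hf; apply: is_derive_cvg.
exact: (cvg_comp _ (@snd V W) hf (@cvg_snd _ _ (nbhs df.1) (nbhs df.2) _)).
Qed.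

Lemma is_derive_sumr (V : normedModType R) (I : finType) (P : pred I) (f : I -> R -> V) (t : R) df :
  (forall i, is_derive t 1 (f i) (df i)) ->
  is_derive t 1 (fun s => \sum_(i | P i) f i s) (\sum_(i | P i) df i).
Proof.
move=> h; apply: is_derive_cvg.
under eq_fun do rewrite -sumrB scaler_sumr.
by apply: cvg_sumr => i; exact: cvg_is_derive.
Qed.

Lemma is_derive_mulr (f g : R -> R) (t : R) df dg :
  is_derive t 1 f df -> is_derive t 1 g dg ->
  is_derive t 1 (fun s => f s * g s) (df * g t + f t * dg).
Proof.
move=> hf hg; apply: is_derive_eq (is_deriveM hf hg) _.
by rewrite addrC; congr (_ + _); rewrite /GRing.scale/= mulrC.
Qed.

Lemma is_derive_cstM (k : R) (f : R -> R) (t : R) df :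
  is_derive t 1 f df -> is_derive t 1 (fun s => k * f s) (k * df).
Proof.
move=> hf; apply: is_derive_eq (is_derive_mulr (is_derive_cst k _ _) hf) _.
by rewrite mul0r add0r.
Qed.

Lemma is_derive_mulmx m n k (A : R -> 'M[R]_(m, n)) (B : R -> 'M[R]_(n, k)) (t : R) dA dB :
  is_derive t 1 A dA -> is_derive t 1 B dB ->
  is_derive t 1 (fun s => A s *m B s) (dA *m B t + A t *m dB).
Proof.
move=> /is_derive_mxP hA /is_derive_mxP hB; apply/is_derive_mxP => i j.
rewrite !mxE -big_split/=; under eq_fun do rewrite mxE.
by apply: is_derive_sumr => h; exact: is_derive_mulr.
Qed.

Lemma is_derive_mulmxr m n k (A : 'M[R]_(m, n)) (B : R -> 'M[R]_(n, k)) (t : R) dB :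
  is_derive t 1 B dB -> is_derive t 1 (fun s => A *m B s) (A *m dB).
Proof.
move=> hB; apply: is_derive_eq (is_derive_mulmx (is_derive_cst _ _ _) hB) _.
by rewrite mul0mx add0r.
Qed.

Lemma is_derive_comp (V W : normedModType R) (f : R -> V) (g : V -> W) (t : R) df :
  differentiable g (f t) -> is_derive t 1 f df ->
  is_derive t 1 (fun s => g (f s)) ('d g (f t) df).
Proof.
move=> dg [/derivable1_diffP dft <-].
have dgf : differentiable (g \o f) t by exact: differentiable_comp.
apply: DeriveDef; first exact/derivable1_diffP.
by rewrite (deriveE _ dgf) diff_comp//= (deriveE _ dft).
Qed.

Lemma is_derive_continuous (V : normedModType R) (f : R -> V) (t : R) df :
  is_derive t 1 f df -> {for t, continuous f}.
Proof. by move=> [/derivable1_diffP/differentiable_continuous]. Qed.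

End matrix_derivatives.

(** * Compact balls and uniform continuity *)

Section compactness.
Context {R : realType}.

(** The Heine-Borel property, as a predicate stable under binary products so that it reaches the
    nested product of matrix spaces used for states. *)
Definition proper_space (V : normedModType R) :=
  forall r : R, compact [set x : V | `|x| <= r].

Lemma proper_space_mx m n : proper_space ('M[R]_(m, n)).
Proof.
move=> r.
(* [vec_mx] only rearranges entries and both norms are the largest absolute entry, so balls
   correspond to balls. *)
have -> : [set x : 'M[R]_(m, n) | `|x| <= r] =
    vec_mx @` [set x : 'rV[R]_(m * n) | `|x| <= r].
  apply/seteqP; split=> [A /= Ar|_ /= [u ur <-]].
    exists (mxvec A); last exact: mxvecK.
    have [r0 h] := (mx_norm_leP _ _).1 Ar; apply/mx_norm_leP; split=> // i.
    by case/mxvec_indexP => j k; rewrite (ord1 i) mxvecE.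
  have [r0 h] := (mx_norm_leP _ _).1 ur; apply/mx_norm_leP; split=> // i j.
  by rewrite mxE.
apply: continuous_compact.
  apply: continuous_subspaceT; apply: continuous_mx => i j.
  by under eq_fun do rewrite mxE; exact: coord_continuous.
apply: bounded_closed_compact.
  by exists r; split=> [|s rs u /= ur]; [exact: num_real|apply: le_trans ur (ltW rs)].
rewrite (_ : mkset _ = Num.Def.normr @^-1` [set s : R | s <= r])//.
by apply: closed_comp; [move=> x _; exact: norm_continuous|exact: closed_le].
Qed.

Lemma prod_norm_leE (V W : normedModType R) (x : V * W) (r : R) :
  (`|x| <= r) = (`|x.1| <= r) && (`|x.2| <= r).
Proof. by rewrite prod_normE ge_max. Qed.

Lemma proper_space_prod (V W : normedModType R) :
  proper_space V -> proper_space W -> proper_space (V * W)%type.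
Proof.
move=> hV hW r.
rewrite (_ : mkset _ = [set x : V | `|x| <= r] `*` [set x : W | `|x| <= r]).
  exact: compact_setX.
by apply/seteqP; split=> x; rewrite /= prod_norm_leE => /andP.
Qed.

Lemma proper_space_bounded (V W : normedModType R) (f : V -> W) (r : R) :
  proper_space V -> continuous f -> exists B, forall x, `|x| <= r -> `|f x| <= B.
Proof.
move=> hV fc; have [r0|r0] := ltP r 0.
  by exists 0 => x xr; have := le_lt_trans xr r0; rewrite ltNge normr_ge0.
have [|||c _ cmax] := @compact_EVT_max _ _ (fun x => `|f x|) [set x : V | `|x| <= r].
- by exists 0; rewrite /= normr0.
- exact: hV.
- by apply: continuous_subspaceT => x; apply: cvg_norm; exact: fc.
by exists `|f c| => x xr; apply: cmax; rewrite inE.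
Qed.

Lemma proper_space_unif_continuous (V W : normedModType R) (f : V -> W) (r e : R) :
  proper_space V -> continuous f -> 0 < e ->
  exists2 d : R, 0 < d & forall x y, `|x| <= r -> `|x - y| < d -> `|f x - f y| < e.
Proof.
move=> hV fc e0.
(* Near-covering form of compactness: the filter [0^'+] of small [d] supplies one modulus valid for
   all centres [x] of the ball. The other point [y] is not confined to it. *)
have := (compact_near_coveringP [set x : V | `|x| <= r]).1 (hV r).
move=> /(_ R 0^'+ (fun d x => forall y, `|x - y| < d -> `|f x - f y| < e)).
case=> [x xr|d d0 hd].
  have e2 : 0 < e / 2 by rewrite divr_gt0.
  have /cvgrPdist_lt/(_ _ e2) := fc x.
  move=> /nbhs_ballP[s /= s0]; rewrite -ball_normE/= => hs.
  near_simpl; near=> z d => y zy.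
  have xz : `|x - z| < s / 2.
    by near: z; apply/nbhs_ballP; exists (s / 2); rewrite /= ?divr_gt0//;
      move=> z; rewrite -ball_normE.
  have ds : d < s / 2 by near: d; apply: nbhs_right_lt; rewrite divr_gt0.
  have xy : `|x - y| < s.
    rewrite -(subrKA z) (le_lt_trans (ler_normD _ _))// (splitr s) ltrD//.
    exact: lt_trans ds.
  have xz' : `|x - z| < s by apply: lt_trans xz _; rewrite ltr_pdivrMr// ltr_pMr// ltr1n.
  rewrite -(subrKA (f x)) (le_lt_trans (ler_normD _ _))// (splitr e) ltrD//.
    by rewrite distrC; exact: hs.
  exact: hs.
exists (d / 2); first by rewrite divr_gt0.
move=> x y xr xy; apply: (hd (d / 2)) => //=.
- by rewrite sub0r normrN gtr0_norm ?divr_gt0// ltr_pdivrMr// ltr_pMr// ltr1n.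
- by rewrite divr_gt0.
Unshelve. all: by end_near. Qed.

End compactness.

(** * Trajectories and Peano's theorem *)

Section trajectories.
Context {R : realType}.

(** The notion of solution of [closed_loop] in an abstract space: nothing is asked for negative
    times, and only right continuity at 0. This is still enough for the mean value theorem on
    [[0, b]]. *)
Definition trajectory (V : normedModType R) (x dx : R -> V) :=
  (x t @[t --> 0^'+] --> x 0) /\ forall t : R, 0 < t -> is_derive t 1 x (dx t).

Lemma trajectory_MVT (f df : R -> R) (a b : R) : trajectory f df -> 0 <= a -> a < b ->
  exists2 c, a < c < b & f b - f a = df c * (b - a).
Proof.
move=> [f0 fd] a0 ab; have fc t : 0 < t -> {for t, continuous f}.
  by move=> t0; exact: is_derive_continuous (fd t t0).
have [|||c] := @MVT R f df a b => //.
- by move=> c; rewrite in_itv/= => /andP[ac _]; apply: fd; exact: le_lt_trans ac.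
- apply/continuous_within_itvP => //; split.
  + by move=> c; rewrite in_itv/= => /andP[ac _]; apply: fc; exact: le_lt_trans ac.
  + move: a0; rewrite le_eqVlt => /predU1P[<-//|a0].
    exact/cvg_at_right_filter/fc.
  + by apply/cvg_at_left_filter/fc; exact: le_lt_trans ab.
- by rewrite in_itv/= => cab ->; exists c.
Qed.

Lemma trajectory_nincr (f df : R -> R) : trajectory f df ->
  (forall t : R, 0 < t -> df t <= 0) -> forall a b : R, 0 <= a -> a <= b -> f b <= f a.
Proof.
move=> fd df0 a b a0; rewrite le_eqVlt => /predU1P[->//|ab].
have [c /andP[ac _] e] := trajectory_MVT fd a0 ab.
rewrite -subr_le0 e mulr_le0_ge0//; last by rewrite subr_ge0 ltW.
by apply: df0; exact: le_lt_trans ac.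
Qed.

(** The scalar mean value theorem applies to each entry. As the norm is a maximum over entries, the
    constant is [L] itself, without a dimension factor. *)
Lemma trajectory_mx_lipschitz m n (x dx : R -> 'M[R]_(m, n)) (L : R) :
  trajectory x dx -> (forall t : R, 0 < t -> `|dx t| <= L) ->
  forall a b : R, 0 <= a -> a <= b -> `|x b - x a| <= L * (b - a).
Proof.
move=> [/cvg_mxP x0 xd] dxL a b a0; rewrite le_eqVlt => /predU1P[->|ab].
  by rewrite !subrr normr0 mulr0.
have L0 : 0 <= L by apply: le_trans (dxL 1 ltr01).
apply/mx_norm_leP; split=> [|i j]; first by rewrite mulr_ge0// subr_ge0 ltW.
have [|c /andP[ac _] e] := @trajectory_MVT (fun t => x t i j) (fun t => dx t i j) a b _ a0 ab.
  by split=> [|t t0]; [exact: x0|exact: (is_derive_mxP _ _ _).1 (xd t t0) i j].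
rewrite !mxE e normrM (@ger0_norm _ (b - a)) ?subr_ge0 ?(ltW ab)//.
rewrite ler_wpM2r ?subr_ge0 ?(ltW ab)//; apply: le_trans (ler_mx_entry _ _ _) _.
by apply: dxL; exact: le_lt_trans ac.
Qed.

Lemma trajectory_fst (V W : normedModType R) (x dx : R -> V * W) :
  trajectory x dx -> trajectory (fun t => (x t).1) (fun t => (dx t).1).
Proof.
move=> [x0 xd]; split=> [|t t0]; last exact: is_derive_fst (xd t t0).
exact: (cvg_comp _ (@fst V W) x0 (@cvg_fst _ _ (nbhs (x 0).1) (nbhs (x 0).2) _)).
Qed.

Lemma trajectory_snd (V W : normedModType R) (x dx : R -> V * W) :
  trajectory x dx -> trajectory (fun t => (x t).2) (fun t => (dx t).2).
Proof.
move=> [x0 xd]; split=> [|t t0]; last exact: is_derive_snd (xd t t0).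
exact: (cvg_comp _ (@snd V W) x0 (@cvg_snd _ _ (nbhs (x 0).1) (nbhs (x 0).2) _)).
Qed.

(** The mean value inequality, made a predicate for the same reason as [proper_space]: it passes
    from matrices to products. *)
Definition mean_value_space (V : normedModType R) :=
  forall (x dx : R -> V) (L : R), trajectory x dx -> (forall t : R, 0 < t -> `|dx t| <= L) ->
  forall a b : R, 0 <= a -> a <= b -> `|x b - x a| <= L * (b - a).

Lemma mean_value_space_mx m n : mean_value_space ('M[R]_(m, n)).
Proof. by move=> x dx L; exact: trajectory_mx_lipschitz. Qed.

Lemma mean_value_space_prod (V W : normedModType R) :
  mean_value_space V -> mean_value_space W -> mean_value_space (V * W)%type.
Proof.
move=> hV hW x dx L xt dxL a b a0 ab; rewrite prod_norm_leE; apply/andP; split.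
- apply: hV (trajectory_fst xt) _ _ _ a0 ab => t /dxL.
  by rewrite prod_norm_leE => /andP[].
- apply: hW (trajectory_snd xt) _ _ _ a0 ab => t /dxL.
  by rewrite prod_norm_leE => /andP[].
Qed.

Lemma nincr_bounded_cvg (f : R -> R) (B : R) :
  (forall a b : R, 0 <= a -> a <= b -> f b <= f a) -> (forall t : R, 0 <= t -> B <= f t) ->
  exists l : R, f t @[t --> +oo] --> l.
Proof.
(* Freezing the argument at 0 makes the function monotone on the whole line, and the sign turns it
   nondecreasing. *)
move=> fn fB; pose g (t : R) := - f (Num.max 0 t).
have gc : g t @[t --> +oo] --> sup (range g).
  apply: nondecreasing_cvgr.
    move=> s t st; rewrite /g lerN2 fn ?le_max ?lexx//.
    by case: (leP 0 s) => ?; case: (leP 0 t) => ?; lra.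
  by exists (- B) => _ [t _ <-]; rewrite /g lerN2 fB// le_max lexx.
exists (- sup (range g)); apply: cvg_trans (cvgN gc).
apply: near_eq_cvg; near=> t; rewrite /g/= opprK max_r//.
Unshelve. all: by end_near. Qed.

(** On a window [[t, t + d / 2]] the mean value theorem finds [c] with [df c] small, because [f]
    hardly varies there; uniform continuity carries the smallness from [c] back to [t]. *)
Lemma barbalat (f df : R -> R) (l : R) :
  trajectory f df -> f t @[t --> +oo] --> l ->
  (forall e : R, 0 < e -> exists2 d : R, 0 < d & forall s t : R, 0 < s -> 0 < t ->
     `|s - t| < d -> `|df s - df t| < e) ->
  df t @[t --> +oo] --> 0.
Proof.
move=> fd fl dfu; apply/cvgrPdist_le => e e0.
have e2 : 0 < e / 2 by rewrite divr_gt0.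
have [d d0 hd] := dfu _ e2.
have d2 : 0 < d / 2 by rewrite divr_gt0.
(* A variation below [e / 2 * (d / 2)] over the window forces [|df c| < e / 2]. The last halving is
   for the two distances to [l] that add up. *)
have k0 : 0 < e / 2 * (d / 2) / 2 by rewrite divr_gt0// mulr_gt0.
have /cvgrPdist_lt/(_ _ k0)[T [_ hT]] := fl.
near=> t.
have t0 : 0 < t by [].
have Tt : T < t by near: t; by apply: nbhs_pinfty_gt; exact: num_real.
have [|c /andP[tc ct] hc] := trajectory_MVT fd (ltW t0) (_ : t < t + d / 2).
  by rewrite ltrDl.
have h1 := hT _ Tt; have h2 : `|l - f (t + d / 2)| < e / 2 * (d / 2) / 2.
  by apply: hT; rewrite (lt_trans Tt)// ltrDl.
have h3 : `|f (t + d / 2) - f t| < e / 2 * (d / 2).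
  rewrite -(subrKA l) (splitr (e / 2 * (d / 2))).
  by rewrite (le_lt_trans (ler_normD _ _))// ltrD// distrC.
move: h3; rewrite hc (addrC t) addrK normrM (gtr0_norm d2) ltr_pM2r// => h3.
rewrite sub0r normrN.
rewrite -(subrK (df c) (df t)) (le_trans (ler_normD _ _))// (splitr e) lerD ?(ltW h3)//.
apply/ltW/hd => //; first exact: lt_trans tc.
rewrite ltr_norml; apply/andP; split; last by lra.
by lra.
Unshelve. all: by end_near. Qed.

End trajectories.

Lemma ultra_fmap (T U : Type) (f : T -> U) (F : set_system T) :
  UltraFilter F -> UltraFilter (f @ F).
Proof.
move=> FU; split; first exact: fmap_proper_filter.
move=> G GF sFG; apply/seteqP; split=> // A GA; have [//|FA] := in_ultra_setVsetC (f @^-1` A) FU.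
have GnA : G (~` A) by exact: sFG.
have GAA : G (A `&` ~` A) by exact: filterI.
by have [x []] := filter_ex GAA.
Qed.

Section peano.
Context {R : realType} (V : normedModType R) (f : V -> V) (L : R) (x0 : V).
Hypothesis Vproper : proper_space V.
Hypothesis fcont : continuous f.
Hypothesis fL : forall x, `|f x| <= L.

Let L0 : 0 <= L. Proof. exact: le_trans (fL 0). Qed.

Definition euler (h : R) (k : nat) : V := iter k (fun y => y + h *: f y) x0.

(** The basic estimate of the scheme: increments stay close to a straight line of slope [c] while
    the field stays close to [c]. With [c = 0] and [e = L] it gives the Lipschitz bound; with
    [c = f y] it gives differentiability in the limit. *)
Lemma euler_near (h e : R) (c : V) a k : 0 <= h ->
  (forall j, (j < k)%N -> `|f (euler h (a + j)) - c| <= e) ->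
  `|euler h (a + k) - euler h a - (k%:R * h) *: c| <= k%:R * h * e.
Proof.
move=> h0; elim: k => [|k ih] hk.
  by rewrite addn0 subrr mul0r scale0r subrr normr0 mul0r.
have -> : euler h (a + k.+1) - euler h a - (k.+1%:R * h) *: c =
    (euler h (a + k) - euler h a - (k%:R * h) *: c) + h *: (f (euler h (a + k)) - c).
  rewrite addnS /= -natr1 mulrDl mul1r scalerDl scalerBr opprD !addrA.
  congr (_ - _); rewrite -!addrA; congr (_ + _).
  by rewrite addrC -addrA.
rewrite -natr1 mulrDl mul1r mulrDl (le_trans (ler_normD _ _))// lerD//.
  by apply: ih => j jk; apply: hk; exact: ltnW.
by rewrite normrZ ger0_norm// ler_wpM2l// hk.
Qed.

Lemma euler_lipschitz (h : R) a k : 0 <= h ->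
  `|euler h (a + k) - euler h a| <= k%:R * h * L.
Proof.
move=> h0; have := @euler_near h L 0 a k h0; rewrite scaler0 subr0; apply.
by move=> j _; rewrite subr0.
Qed.

Let step (n : nat) : R := n.+1%:R^-1.
Let step0 n : 0 < step n. Proof. by rewrite invr_gt0 ltr0n. Qed.
Let idx n (t : R) : nat := Num.truncn (t / step n).
(** The scheme is extended to real times as a step function, not as a broken line. It is therefore
    Lipschitz only up to one step; the terms in [step n] of the estimates below record this and
    vanish in the limit. *)
Let X n (t : R) := euler (step n) (idx n t).

Let idx_le n (s t : R) : 0 <= s -> s <= t -> (idx n s <= idx n t)%N.
Proof. by move=> s0 st; apply: le_truncn; rewrite ler_pM2r// invr_gt0. Qed.

Let idx_dist n (s t : R) : 0 <= s -> s <= t ->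
  `|(idx n t - idx n s)%:R * step n - (t - s)| <= step n.
Proof.
move=> s0 st; have := step0 n => h0.
have hi (u : R) : 0 <= u -> (idx n u)%:R * step n <= u < (idx n u).+1%:R * step n.
  move=> u0; have /andP[h1 h2] := @truncn_itv R (u / step n) (divr_ge0 u0 (ltW h0)).
  by rewrite -ler_pdivlMr// h1 -ltr_pdivrMr.
have /andP[s1 s2] := hi s s0; have /andP[t1 t2] := hi t (le_trans s0 st).
rewrite natrB ?idx_le// mulrBl.
move: s2 t2; rewrite -!natr1 !mulrDl !mul1r => s2 t2.
by rewrite ler_norml; apply/andP; split; lra.
Qed.

Let X_split n (s t : R) : 0 <= s -> s <= t ->
  X n t = euler (step n) (idx n s + (idx n t - idx n s)).
Proof. by move=> s0 st; rewrite subnKC// idx_le. Qed.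

Let X_lipschitz n (s t : R) : 0 <= s -> s <= t -> `|X n t - X n s| <= (t - s + step n) * L.
Proof.
move=> s0 st; rewrite (X_split _ s0 st); apply: le_trans (euler_lipschitz _ _ (ltW (step0 n))) _.
rewrite ler_wpM2r//; have := idx_dist n s0 st.
by rewrite ler_norml => /andP[_]; rewrite lerBlDr addrC.
Qed.

Let X_near n (s t : R) (y : V) (r e : R) : 0 <= s -> s <= t ->
  (forall z : V, `|z - y| <= r -> `|f z - f y| <= e) ->
  `|X n s - y| + (t - s + step n) * L <= r ->
  `|X n t - X n s - (t - s) *: f y| <= (t - s + step n) * e + step n * L.
Proof.
move=> s0 st hr hn; have h0 := ltW (step0 n).
set k := (idx n t - idx n s)%N.
have hd := idx_dist n s0 st.
have kh : k%:R * step n <= t - s + step n.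
  by move: hd; rewrite ler_norml => /andP[_]; rewrite lerBlDr addrC.
have r0 : 0 <= r.
  by apply: le_trans hn; rewrite addr_ge0// mulr_ge0// addr_ge0 ?subr_ge0.
have e0 : 0 <= e by apply: le_trans (hr y _); rewrite ?subrr normr0.
have -> : X n t - X n s - (t - s) *: f y =
    (X n t - X n s - (k%:R * step n) *: f y) + (k%:R * step n - (t - s)) *: f y.
  by rewrite (scalerBl (k%:R * step n)) addrA subrK.
rewrite (le_trans (ler_normD _ _))// lerD//; last first.
  by rewrite normrZ ler_pM.
rewrite (X_split _ s0 st) -/k; apply: le_trans (_ : k%:R * step n * e <= _); last first.
  exact: ler_wpM2r.
apply: euler_near => // j jk; apply: hr.
rewrite -(subrKA (X n s)) (le_trans (ler_normD _ _))// addrC.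
apply: le_trans hn; rewrite lerD2l; apply: le_trans (euler_lipschitz _ _ h0) _.
rewrite ler_wpM2r//; apply: le_trans kh; rewrite ler_wpM2r// ler_nat.
exact: ltnW.
Qed.

(** An ultrafilter finer than [\oo] makes [X n t] converge for all [t >= 0] simultaneously, each
    value staying in a compact ball, so no subsequence is extracted. The two estimates on [X n] pass
    to the limit, and the second yields the derivative. *)
Theorem peano_existence :
  exists x : R -> V, x 0 = x0 /\ trajectory x (f \o x).
Proof.
have [U [UU sU]] := @ultraFilterLemma nat \oo _.
have UF : ProperFilter U by exact: ultra_proper.
have stepU : step n @[n --> U] --> (0 : R).
  by apply: cvg_trans (@cvg_harmonic R) => A /sU.
have limX (t : R) : 0 <= t -> exists y : V, X n t @[n --> U] --> y.
  (* The time [t + 1] instead of [t] absorbs the error of one step, as [step n <= 1]. *)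
  move=> t0; have := @Vproper (`|x0| + (t + 1) * L); rewrite compact_ultra.
  move=> /(_ ((X ^~ t) @ U) (ultra_fmap _ UU)) [].
    near_simpl; apply: nearW => n /=.
    have := @X_lipschitz n 0 t (lexx 0) t0.
    have -> : X n 0 = x0 by rewrite /X /idx mul0r truncn0.
    move=> h; rewrite -(subrK x0 (X n t)) addrC (le_trans (ler_normD _ _))// lerD2l.
    apply: le_trans h _; rewrite subr0 ler_wpM2r// lerD2l /step.
    by rewrite invf_le1 ?ltr0n// ler1n.
  by move=> y [_ hy]; exists y.
(* The value [x0] at negative times is a default that [trajectory] never inspects. *)
pose x (t : R) := if pselect (0 <= t) is left h then sval (cid (limX t h)) else x0.
have xP (t : R) : 0 <= t -> X n t @[n --> U] --> x t.
  by move=> t0; rewrite /x; case: pselect => // h; exact: (svalP (cid (limX t h))).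
have x00 : x 0 = x0.
  apply: (cvg_unique _ (xP 0 (lexx 0))) => //.
  rewrite (_ : (fun n => X n 0) = fun=> x0); first exact: cvg_cst.
  by apply/funext => n; rewrite /X /idx mul0r truncn0.
have xlip (s t : R) : 0 <= s -> s <= t -> `|x t - x s| <= (t - s) * L.
  move=> s0 st; have h1 : `|X n t - X n s| @[n --> U] --> `|x t - x s|.
    by apply: cvg_norm; apply: cvgB; apply: xP => //; exact: le_trans st.
  have h2 : (t - s + step n) * L @[n --> U] --> (t - s + 0) * L.
    by apply: cvgMr_tmp; apply: cvgD => //; exact: cvg_cst.
  rewrite addr0 in h2; apply: ler_cvg_to h1 h2 _.
  by apply: nearW => n; exact: X_lipschitz.
have xnear (s t : R) y r e : 0 <= s -> s <= t ->
    (forall z : V, `|z - y| <= r -> `|f z - f y| <= e) ->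
    `|x s - y| + (t - s) * L < r ->
    `|x t - x s - (t - s) *: f y| <= (t - s) * e.
  move=> s0 st hr hn.
  have h1 : `|X n t - X n s - (t - s) *: f y| @[n --> U] --> `|x t - x s - (t - s) *: f y|.
    apply: cvg_norm; apply: cvgB; last exact: cvg_cst.
    by apply: cvgB; apply: xP => //; exact: le_trans st.
  have h2 : (t - s + step n) * e + step n * L @[n --> U] --> (t - s + 0) * e + 0 * L.
    apply: cvgD; apply: cvgMr_tmp => //; apply: cvgD => //; exact: cvg_cst.
  rewrite addr0 mul0r addr0 in h2; apply: ler_cvg_to h1 h2 _.
  have h3 : `|X n s - y| + (t - s + step n) * L @[n --> U] --> `|x s - y| + (t - s + 0) * L.
    apply: cvgD; last by apply: cvgMr_tmp; apply: cvgD => //; exact: cvg_cst.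
    by apply: cvg_norm; apply: cvgB; [exact: xP|exact: cvg_cst].
  (* The strict inequality assumed on the limit becomes the weak one required by [X_near] for
     [U]-almost all [n]. *)
  rewrite addr0 in h3; have h4 := @cvgr_le _ _ U _ _ _ h3 _ hn.
  by near=> n; apply: X_near s0 st hr _; near: n; exact: h4.
exists x; split=> //; split.
  apply/cvgrPdist_le => e e0; near=> t.
  have t0 : 0 < t by [].
  rewrite distrC; apply: le_trans (xlip 0 t (lexx 0) (ltW t0)) _; rewrite subr0.
  apply: le_trans (_ : t * (L + 1) <= _); first by rewrite ler_wpM2l ?ltW// ltrDl.
  rewrite -ler_pdivlMr ?ltr_wpDl//.
  by near: t; apply: nbhs_right_le; rewrite divr_gt0// ltr_wpDl.
move=> t t0 /=; apply: is_derive_cvg; apply/cvgrPdist_le => e e0.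
have /cvgrPdist_le/(_ _ e0)/nbhs_ballP[r /= r0] := @fcont (x t).
rewrite -ball_normE/= => hr.
have {}hr z : `|z - x t| <= r / 2 -> `|f z - f (x t)| <= e.
  move=> h; rewrite distrC; apply: hr => /=; rewrite distrC (le_lt_trans h)//.
  by rewrite ltr_pdivrMr// ltr_pMr// ltr1n.
have L21 : 0 < L * 2 + 1 by rewrite ltr_wpDl// mulr_ge0.
near=> h.
have hn0 : h != 0 by near: h; exact: nbhs_dnbhs_neq.
have ht : `|h| < t by near: h; exact: dnbhs0_lt.
have hL : `|h| * L *+ 2 < r / 2.
  rewrite -mulr_natr -mulrA; apply: le_lt_trans (_ : `|h| * (L * 2 + 1) < _).
    by rewrite ler_wpM2l// lerDl.
  rewrite -ltr_pdivlMr//.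
  by near: h; apply: dnbhs0_lt; rewrite !divr_gt0.
have hL' : `|h| * L < r / 2.
  by apply: le_lt_trans hL; rewrite mulr2n lerDl mulr_ge0.
suff : `|h *: f (x t) - (x (h + t) - x t)| <= `|h| * e.
  move=> H; rewrite -(@ler_pM2l _ `|h|) ?normr_gt0// -normrZ scalerBr scalerA.
  by rewrite mulfV// scale1r [h *: 1]mulr1.
have [h0|h0] := ltP 0 h.
  have := @xnear t (h + t) (x t) (r / 2) e (ltW t0).
  rewrite addrK subrr normr0 add0r lerDr (ltW h0) -{1 3}(gtr0_norm h0).
  by move=> /(_ isT hr hL'); rewrite distrC gtr0_norm.
have h0' : h < 0 by rewrite lt_neqAle hn0.
have hE : `|h| = - h by rewrite ltr0_norm.
have th : t - (h + t) = `|h| by rewrite hE opprD addrCA subrr addr0.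
have ht0 : 0 <= h + t by rewrite -(opprK h) -hE addrC subr_ge0 ltW.
have htt : h + t <= t by rewrite gerDr.
(* For [h < 0] the interval starts at [h + t], yet the slope is still [f (x t)]: hence a centre [y]
   in [xnear] unrelated to [x s]. The doubled drift in [hL] pays both for the distance from
   [x (h + t)] to [x t] and for the motion over the interval. *)
have := @xnear (h + t) t (x t) (r / 2) e ht0 htt hr.
have := xlip _ _ ht0 htt; rewrite th => l1.
have l2 : `|x (h + t) - x t| + `|h| * L < r / 2.
  by apply: le_lt_trans hL; rewrite mulr2n lerD2r distrC.
move=> /(_ l2); rewrite hE scaleNr opprK => H.
by rewrite opprB addrC.
Unshelve. all: by end_near. Qed.

End peano.

(** * Euclidean product and leader matrices *)

Section dot_product.
Context {R : realType}.

Definition dot m (x y : 'cV[R]_m) : R := \sum_k x k ord0 * y k ord0.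

Lemma dotE m (x y : 'cV[R]_m) : (x^T *m y) ord0 ord0 = dot x y.
Proof. by rewrite mxE; apply: eq_bigr => k _; rewrite mxE. Qed.

Lemma dotC m (x y : 'cV[R]_m) : dot x y = dot y x.
Proof. by apply: eq_bigr => k _; rewrite mulrC. Qed.

Lemma dotDr m (x y z : 'cV[R]_m) : dot x (y + z) = dot x y + dot x z.
Proof. by rewrite -big_split; apply: eq_bigr => k _; rewrite mxE mulrDr. Qed.

Lemma dotZr m c (x y : 'cV[R]_m) : dot x (c *: y) = c * dot x y.
Proof. by rewrite mulr_sumr; apply: eq_bigr => k _; rewrite mxE mulrCA. Qed.

Lemma dotNr m (x y : 'cV[R]_m) : dot x (- y) = - dot x y.
Proof. by rewrite -scaleN1r dotZr mulN1r. Qed.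

Lemma dotBr m (x y z : 'cV[R]_m) : dot x (y - z) = dot x y - dot x z.
Proof. by rewrite dotDr dotNr. Qed.

Lemma dotDl m (x y z : 'cV[R]_m) : dot (x + y) z = dot x z + dot y z.
Proof. by rewrite dotC dotDr !(dotC z). Qed.

Lemma dotZl m c (x y : 'cV[R]_m) : dot (c *: x) y = c * dot x y.
Proof. by rewrite dotC dotZr dotC. Qed.

Lemma dotNl m (x y : 'cV[R]_m) : dot (- x) y = - dot x y.
Proof. by rewrite dotC dotNr dotC. Qed.

Lemma dotBl m (x y z : 'cV[R]_m) : dot (x - y) z = dot x z - dot y z.
Proof. by rewrite dotDl dotNl. Qed.

Lemma dot_suml m (I : finType) (P : pred I) (x : I -> 'cV[R]_m) y :
  dot (\sum_(i | P i) x i) y = \sum_(i | P i) dot (x i) y.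
Proof.
rewrite exchange_big/=; apply: eq_bigr => k _.
by rewrite summxE mulr_suml.
Qed.

Lemma dot_mulmxr m n (A : 'M[R]_(m, n)) x y : dot x (A *m y) = dot (A^T *m x) y.
Proof. by rewrite -!dotE mulmxA trmx_mul trmxK. Qed.

Lemma dot_skew m (A : 'M[R]_m) x : A^T = - A -> dot x (A *m x) = 0.
Proof.
move=> AN; have : dot x (A *m x) = - dot x (A *m x).
  by rewrite {1}dot_mulmxr AN mulNmx dotNl dotC.
by move=> h; lra.
Qed.

Lemma ler_sum_term (I : finType) (f : I -> R) i : (forall j, 0 <= f j) ->
  f i <= \sum_j f j.
Proof. by move=> f0; rewrite (bigD1 i)//= lerDl sumr_ge0. Qed.

Lemma dot_ge0 m (x : 'cV[R]_m) : 0 <= dot x x.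
Proof. by apply: sumr_ge0 => k _; rewrite -expr2 sqr_ge0. Qed.

Lemma dot_entry m (x : 'cV[R]_m) k : x k ord0 ^+ 2 <= dot x x.
Proof.
rewrite expr2; apply: (@ler_sum_term _ (fun k => x k ord0 * x k ord0)).
by move=> j; rewrite -expr2 sqr_ge0.
Qed.

Lemma norm_le_dot m (x : 'cV[R]_m) (r : R) : 0 <= r -> dot x x <= r ^+ 2 -> `|x| <= r.
Proof.
move=> r0 xr; apply/mx_norm_leP; split=> // i j; rewrite (ord1 j).
by rewrite -ler_sqr ?nnegrE// real_normK ?num_real// (le_trans (dot_entry _ _)).
Qed.

(** [r <= (r + 1) ^+ 2] for [r >= 0]; this crude form avoids square roots where only the existence
    of a bound matters. *)
Lemma norm_le_dot1 m (x : 'cV[R]_m) (r : R) : dot x x <= r -> `|x| <= r + 1.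
Proof.
move=> xr; have r0 := le_trans (dot_ge0 x) xr.
by apply: norm_le_dot; [rewrite addr_ge0|apply: le_trans xr _; nra].
Qed.

(** Expansion of the square of [(2 * c) *: x - y]. *)
Lemma dot_young m (c : R) (x y : 'cV[R]_m) : 0 < c ->
  dot x y <= c * dot x x + (4 * c)^-1 * dot y y.
Proof.
move=> c0; have := dot_ge0 ((2 * c) *: x - y).
rewrite dotBl !dotBr !dotZl !dotZr (dotC y x) => h.
have c4 : 0 < 4 * c by rewrite mulr_gt0.
rewrite -(ler_pM2l c4) mulrDr mulrA mulrA divff ?gt_eqF// mul1r; nra.
Qed.

Lemma dot_quad_bound m (B : 'M[R]_m) (x : 'cV[R]_m) :
  dot x (B *m x) <= (\sum_i \sum_j `|B i j|) * dot x x.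
Proof.
rewrite mulr_suml; apply: ler_sum => i _.
rewrite mxE mulr_sumr mulr_suml; apply: ler_sum => j _.
apply: le_trans (ler_norm _) _; rewrite mulrCA !normrM ler_wpM2l//.
have /= := dot_entry x i; have /= := dot_entry x j.
rewrite -(real_normK (num_real (x i ord0))) -(real_normK (num_real (x j ord0))).
move: `|x i ord0| `|x j ord0| => a b h1 h2; nra.
Qed.

Lemma dot_mulmx_bound m n (A : 'M[R]_(m, n)) : exists2 c : R, 0 <= c &
  forall x, dot (A *m x) (A *m x) <= c * dot x x.
Proof.
exists (\sum_i \sum_j `|(A^T *m A) i j|); first by do 2!apply: sumr_ge0 => ? _.
by move=> x; rewrite dot_mulmxr dotC mulmxA; exact: dot_quad_bound.
Qed.

Lemma norm_mulmx_le m n k (A : 'M[R]_(m, n)) (B : 'M[R]_(n, k)) :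
  `|A *m B| <= n%:R * (`|A| * `|B|).
Proof.
apply/mx_norm_leP; split=> [|i j]; first by rewrite !mulr_ge0.
rewrite mxE; apply: le_trans (ler_norm_sum _ _ _) _.
rewrite mulr_natl -[X in _ *+ X]card_ord -sumr_const; apply: ler_sum => h _.
by rewrite normrM ler_pM// ler_mx_entry.
Qed.

Lemma ler_norm_dot m (x y : 'cV[R]_m) : `|dot x y| <= m%:R * (`|x| * `|y|).
Proof.
rewrite -dotE; apply: le_trans (ler_mx_entry _ _ _) _.
apply: le_trans (norm_mulmx_le _ _) _; rewrite ler_wpM2l// ler_wpM2r//.
by apply/mx_norm_leP; split=> // i j; rewrite mxE ler_mx_entry.
Qed.

Lemma unitmx_dot m (A : 'M[R]_m) :
  (forall x : 'cV[R]_m, x != 0 -> 0 < dot x (A *m x)) -> A \in unitmx.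
Proof.
move=> Apos; rewrite -row_free_unit -kermx_eq0; apply/rowV0P => u /sub_kermxP uA.
apply/eqP/negPn/negP => u0; have := Apos u^T; rewrite -dotE mulmxA trmxK uA mul0mx.
by rewrite mxE ltxx trmx_eq0 u0 => /(_ isT).
Qed.

(* Cauchy-Schwarz for the form [A]: solving [A y = e_k] gives
   [x_k ^ 2 <= y_k * dot x (A x)]. *)
Lemma posdef_coercive m (A : 'M[R]_m) : posdef A ->
  exists2 c : R, 0 < c & forall x, c * dot x x <= dot x (A *m x).
Proof.
move=> [As Ap].
have Ap' (x : 'cV[R]_m) : x != 0 -> 0 < dot x (A *m x).
  by move=> /Ap; rewrite -dotE mulmxA.
have Ap0 (x : 'cV[R]_m) : 0 <= dot x (A *m x).
  by have [->|/Ap'/ltW//] := eqVneq x 0; rewrite mulmx0 -dotE mulmx0 mxE.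
have Au : A \in unitmx by exact: unitmx_dot.
pose e (k : 'I_m) : 'cV[R]_m := delta_mx k ord0; pose y k := invmx A *m e k.
have Ay k : A *m y k = e k by rewrite mulKVmx.
have dote (x : 'cV[R]_m) k : dot x (e k) = x k ord0.
  rewrite /dot (bigD1 k)//= big1 ?addr0 ?mxE ?eqxx ?mulr1// => j jk.
  by rewrite mxE (negbTE jk) mulr0.
have y0 k : 0 < y k k ord0.
  rewrite -dote -Ay; apply: Ap'; apply/eqP => yk0.
  have := Ay k; rewrite yk0 mulmx0 => /matrixP/(_ k ord0).
  by rewrite !mxE !eqxx => /eqP; rewrite eq_sym oner_eq0.
have key (x : 'cV[R]_m) k : x k ord0 * x k ord0 <= y k k ord0 * dot x (A *m x).
  have := Ap0 (y k k ord0 *: x - x k ord0 *: y k).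
  rewrite mulmxBr -!scalemxAr Ay dotBl !dotBr !dotZl !dotZr !dote.
  rewrite (dot_mulmxr A (y k)) As Ay (dotC (e k)) dote => h.
  by rewrite -(ler_pM2l (y0 k)); nra.
have s0 : 0 <= \sum_k y k k ord0 by apply: sumr_ge0 => k _; exact: ltW.
exists (1 + \sum_k y k k ord0)^-1; first by rewrite invr_gt0 ltr_wpDr.
move=> x; rewrite mulrC ler_pdivrMr ?ltr_wpDr// mulrDr mulr1.
rewrite -[leLHS]add0r lerD// mulrC mulr_suml; apply: ler_sum => k _; exact: key.
Qed.

Lemma cvg_dot (T : Type) (F : set_system T) {FF : Filter F} m
    (x y : T -> 'cV[R]_m) (a b : 'cV[R]_m) :
  x t @[t --> F] --> a -> y t @[t --> F] --> b -> dot (x t) (y t) @[t --> F] --> dot a b.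
Proof.
move=> /cvg_mxP xa /cvg_mxP yb; apply: cvg_sumr => k.
by apply: cvgM; [exact: xa|exact: yb].
Qed.

Lemma cvg0_dot (T : Type) (F : set_system T) {FF : Filter F} m (x : T -> 'cV[R]_m) :
  dot (x t) (x t) @[t --> F] --> 0 -> x t @[t --> F] --> (0 : 'cV[R]_m).
Proof.
move=> h; apply/cvgrPdist_le => e e0; rewrite near_simpl.
have e20 : 0 < e ^+ 2 by rewrite exprn_gt0.
have /cvgrPdist_le/(_ _ e20) := h; apply: filterS => t.
rewrite !sub0r !normrN ger0_norm ?dot_ge0// => he.
exact: norm_le_dot (ltW e0) he.
Qed.

Lemma is_derive_dot m (x y : R -> 'cV[R]_m) (t : R) dx dy :
  is_derive t 1 x dx -> is_derive t 1 y dy ->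
  is_derive t 1 (fun s => dot (x s) (y s)) (dot dx (y t) + dot (x t) dy).
Proof.
move=> /is_derive_mxP hx /is_derive_mxP hy.
rewrite /dot -big_split/=.
by apply: is_derive_sumr => k; exact: is_derive_mulr.
Qed.

Lemma is_derive_sqdot m (x : R -> 'cV[R]_m) (t : R) dx :
  is_derive t 1 x dx ->
  is_derive t 1 (fun s => 2^-1 * dot (x s) (x s)) (dot (x t) dx).
Proof.
move=> hx; pose c : R := 2^-1.
apply: is_derive_eq (is_derive_mulr (is_derive_cst c _ _) (is_derive_dot hx hx)) _.
by rewrite /cst mul0r add0r (dotC dx) /c; lra.
Qed.

End dot_product.

Section leader_matrices.
Context {R : realType}.

Lemma mxvec_index_eq m n (i i' : 'I_m) (k k' : 'I_n) :
  (mxvec_index i k == mxvec_index i' k') = (i == i') && (k == k').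
Proof.
apply/eqP/andP => [|[/eqP-> /eqP->]//].
by move=> /cast_ord_inj/enum_rank_inj[-> ->].
Qed.

Lemma sum_mxvec_index m n (V : nmodType) (f : 'I_(m * n) -> V) :
  \sum_c f c = \sum_i \sum_k f (mxvec_index i k).
Proof.
rewrite (reindex _ (curry_mxvec_bij _ _))/= pair_bigA/=.
by apply: eq_bigr => -[].
Qed.

Lemma kronE m1 n1 m2 n2 (A : 'M[R]_(m1, n1)) (B : 'M[R]_(m2, n2)) i k j h :
  kron A B (mxvec_index i k) (mxvec_index j h) = A i j * B k h.
Proof.
rewrite mxE (bigD1 i)//= [X in _ + X]big1 => [|i' ne]; last first.
  rewrite big1// => k' _; rewrite big1// => j' _; rewrite big1// => h' _.
  by rewrite mxvec_index_eq eq_sym (negbTE ne) mul0r.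
rewrite addr0 (bigD1 k)//= [X in _ + X]big1 => [|k' ne]; last first.
  rewrite big1// => j' _; rewrite big1// => h' _.
  by rewrite mxvec_index_eq (eq_sym k) (negbTE ne) andbF mul0r.
rewrite addr0 (bigD1 j)//= [X in _ + X]big1 => [|j' ne]; last first.
  rewrite big1// => h' _.
  by rewrite (mxvec_index_eq j) (eq_sym j) (negbTE ne) andbF mul0r.
rewrite addr0 (bigD1 h)//= [X in _ + X]big1 => [|h' ne]; last first.
  by rewrite (mxvec_index_eq j) (eq_sym h) (negbTE ne) !andbF mul0r.
by rewrite addr0 !eqxx mul1r.
Qed.

Lemma SmatE l (z : 'cV[R]_l) i k j h :
  Smat z (mxvec_index i k) (mxvec_index j h) = amat R k h *+ (i == j) * z i ord0.
Proof.
rewrite kronE mxE mxE; have [->|_] := eqVneq i j; first by rewrite !mulr1n mulrC.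
by rewrite !mulr0n !mul0r.
Qed.

Lemma SmatB l (z w : 'cV[R]_l) : Smat (z - w) = Smat z - Smat w.
Proof.
apply/matrixP => r c; case/mxvec_indexP: r => i k; case/mxvec_indexP: c => j h.
rewrite [RHS]mxE [X in _ = _ + X]mxE !SmatE -mulrBr; congr (_ * _).
by rewrite !mxE.
Qed.

Lemma SmatZ l c (z : 'cV[R]_l) : Smat (c *: z) = c *: Smat z.
Proof.
apply/matrixP => r s; case/mxvec_indexP: r => i k; case/mxvec_indexP: s => j h.
by rewrite [RHS]mxE !SmatE [(c *: z) _ _]mxE mulrCA.
Qed.

Lemma Smat_skew l (z : 'cV[R]_l) : (Smat z)^T = - Smat z.
Proof.
apply/matrixP => r s; case/mxvec_indexP: r => i k; case/mxvec_indexP: s => j h.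
rewrite mxE [RHS]mxE !SmatE eq_sym; have [->|_] := eqVneq i j; last first.
  by rewrite !mulr0n !mul0r oppr0.
rewrite !mulr1n -mulNr; congr (_ * _).
by case: k => -[|[|//]] ?; case: h => -[|[|//]] ?; rewrite !mxE -!val_eqE/= ?oppr0 ?opprK.
Qed.

(** The identity that dictates the form of [phi]: with [w = om_i - om0], the left side comes from
    the adaptation law and the right side is the effect of the wrong frequency on the energy, so the
    two cancel. *)
Lemma dot_phi l (w : 'cV[R]_l) (e y : 'cV[R]_(l * 2)) :
  dot w (phi e *m y) = dot e (Smat w *m y).
Proof.
have Sy k h : (Smat w *m y) (mxvec_index k h) ord0 =
    w k ord0 * \sum_h' amat R h h' * y (mxvec_index k h') ord0.
  rewrite mxE sum_mxvec_index (bigD1 k)//= [X in _ + X]big1 ?addr0; last first.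
    move=> j jk; rewrite big1// => h' _.
    by rewrite SmatE eq_sym (negbTE jk) mulr0n !mul0r.
  by rewrite mulr_sumr; apply: eq_bigr => h' _; rewrite SmatE eqxx mulr1n mulrAC mulrC.
rewrite [RHS]/dot sum_mxvec_index; apply: eq_bigr => k _.
have -> : (phi e *m y) k ord0 = - e (mxvec_index k i1_2) ord0 * y (mxvec_index k i0_2) ord0 +
    e (mxvec_index k i0_2) ord0 * y (mxvec_index k i1_2) ord0.
  have sel a (z : R) : \sum_c (c == a)%:R * z * y c ord0 = z * y a ord0.
    rewrite (bigD1 a)//= eqxx mul1r big1 ?addr0// => c ca.
    by rewrite (negbTE ca) !mul0r.
  rewrite mxE -!sel -big_split/=; apply: eq_bigr => c _.
  by rewrite mxE mulrDl.
rewrite !big_ord_recl !big_ord0 !Sy !big_ord_recl !big_ord0 !mxE -!val_eqE/=.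
have -> : lift ord0 ord0 = i1_2 :> 'I_2 by exact: val_inj.
by rewrite /i0_2; ring.
Qed.

Lemma norm_Smat l (z : 'cV[R]_l) : `|Smat z| <= `|z|.
Proof.
apply/mx_norm_leP; split=> // r s; case/mxvec_indexP: r => i k; case/mxvec_indexP: s => j h.
rewrite SmatE normrM -[leRHS]mul1r ler_pM// ?ler_mx_entry//.
case: (i == j); rewrite ?mulr1n ?mulr0n ?normr0// mxE.
by case: ifP => _; [|case: ifP => _]; rewrite ?normrN ?normr1 ?normr0.
Qed.

Lemma cvg_Smat (T : Type) (F : set_system T) {FF : Filter F} l (z : T -> 'cV[R]_l)
    (a : 'cV[R]_l) :
  z t @[t --> F] --> a -> Smat (z t) @[t --> F] --> Smat a.
Proof.
move=> /cvg_mxP za; apply/cvg_mxP => r s.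
case/mxvec_indexP: r => i k; case/mxvec_indexP: s => j h.
under eq_fun do rewrite SmatE; rewrite SmatE.
by apply: cvgM; [exact: cvg_cst|exact: za].
Qed.

Lemma is_derive_Smat l (z : R -> 'cV[R]_l) (t : R) dz :
  is_derive t 1 z dz -> is_derive t 1 (fun s => Smat (z s)) (Smat dz).
Proof.
move=> /is_derive_mxP hz; apply/is_derive_mxP => r s.
case/mxvec_indexP: r => i k; case/mxvec_indexP: s => j h.
under eq_fun do rewrite SmatE; rewrite SmatE.
apply: is_derive_eq (is_derive_mulr (is_derive_cst _ _ _) (hz i ord0)) _.
by rewrite mul0r add0r.
Qed.

Lemma cvg_phi (T : Type) (F : set_system T) {FF : Filter F} l (x : T -> 'cV[R]_(l * 2))
    (a : 'cV[R]_(l * 2)) :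
  x t @[t --> F] --> a -> phi (x t) @[t --> F] --> phi a.
Proof.
move=> /cvg_mxP xa; apply/cvg_mxP => k c; under eq_fun do rewrite mxE; rewrite mxE.
apply: cvgD; apply: cvgM; try exact: cvg_cst; last exact: xa.
by apply: cvgN; exact: xa.
Qed.

End leader_matrices.

(** * Graph energy *)

Section graph_energy.
Context {R : realType} (N m : nat) (E : rel 'I_N.+1).
Implicit Types (v : 'cV[R]_m) (eta u : 'I_N -> 'cV[R]_m).

Let lead i : R := (E ord0 (lift ord0 i))%:R.
Let adj i j : R := (E (lift ord0 j) (lift ord0 i))%:R.

Definition disagreement v eta (i : 'I_N) : 'cV[R]_m :=
  \sum_(j < N.+1 | E j (lift ord0 i)) (nodeval v eta j - eta i).

(** On an undirected follower graph this is half the quadratic form, at the errors [eta i - v], of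
    the follower Laplacian plus the diagonal of leader links. The double sum meets each follower
    edge in both orders, hence 1/4 against 1/2. *)
Definition energy v eta : R :=
  4^-1 * (\sum_i \sum_j (E (lift ord0 j) (lift ord0 i))%:R * dot (eta i - eta j) (eta i - eta j)) +
  2^-1 * (\sum_i (E ord0 (lift ord0 i))%:R * dot (eta i - v) (eta i - v)).

Lemma nodeval0 v eta : nodeval v eta ord0 = v.
Proof. by rewrite /nodeval unlift_none. Qed.

Lemma nodeval_lift v eta i : nodeval v eta (lift ord0 i) = eta i.
Proof. by rewrite /nodeval liftK. Qed.

Lemma disagreementE v eta i : disagreement v eta i =
  lead i *: (v - eta i) + \sum_j adj i j *: (eta j - eta i).
Proof.
rewrite /disagreement big_mkcond big_ord_recl nodeval0 /lead /adj; congr (_ + _).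
  by case: ifP; rewrite ?scale1r ?scale0r.
apply: eq_bigr => j _; rewrite nodeval_lift.
by case: ifP; rewrite ?scale1r ?scale0r.
Qed.

Hypothesis Eundirected : forall i j : 'I_N,
  E (lift ord0 i) (lift ord0 j) = E (lift ord0 j) (lift ord0 i).

(** Exchanging [i] and [j] symmetrises the follower terms; this is where undirectedness is used. The
    test vectors [u] are left free: [u i = eta i - v] gives the energy, and the velocities give its
    derivative. *)
Lemma sum_disagreement v eta u :
  \sum_i dot (disagreement v eta i) (u i) =
  - (2^-1 * (\sum_i \sum_j (E (lift ord0 j) (lift ord0 i))%:R *
       dot (eta i - eta j) (u i - u j)) +
     \sum_i (E ord0 (lift ord0 i))%:R * dot (eta i - v) (u i)).
Proof.
pose s1 := \sum_i \sum_j adj i j * dot (eta i - eta j) (u i).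
have s2 : \sum_i \sum_j adj i j * dot (eta i - eta j) (u j) = - s1.
  rewrite exchange_big/= -sumrN; apply: eq_bigr => i _.
  rewrite -sumrN; apply: eq_bigr => j _.
  by rewrite /adj Eundirected -mulrN -dotNl opprB.
have -> : \sum_i \sum_j (E (lift ord0 j) (lift ord0 i))%:R * dot (eta i - eta j) (u i - u j) =
    s1 + s1.
  rewrite -[X in _ + X]opprK -s2 -sumrB; apply: eq_bigr => i _.
  by rewrite -sumrB; apply: eq_bigr => j _; rewrite dotBr mulrBr.
have -> : \sum_i dot (disagreement v eta i) (u i) =
    - s1 - \sum_i lead i * dot (eta i - v) (u i).
  rewrite -!sumrN -big_split/=; apply: eq_bigr => i _.
  rewrite disagreementE [LHS]dotDl addrC -mulrN -dotNl opprB -sumrN; congr (_ + _).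
    by rewrite dotZl.
  rewrite dot_suml.
  by apply: eq_bigr => j _; rewrite dotZl -mulrN -dotNl opprB.
by rewrite /lead; lra.
Qed.

(** Turns the decay of the disagreements into decay of the energy, as soon as [eta i - v] is
    bounded, without any eigenvalue of the Laplacian. *)
Lemma energyE v eta :
  \sum_i dot (disagreement v eta i) (eta i - v) = - (2 * energy v eta).
Proof.
rewrite sum_disagreement /energy.
under eq_bigr do under eq_bigr do rewrite opprB addrA subrK.
by lra.
Qed.

Lemma energy_ge0 v eta : 0 <= energy v eta.
Proof.
rewrite addr_ge0// mulr_ge0 ?invr_ge0//.
- by do 2![apply: sumr_ge0 => ? _]; rewrite mulr_ge0 ?dot_ge0.
- by apply: sumr_ge0 => ? _; rewrite mulr_ge0 ?dot_ge0.
Qed.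

(** All terms are nonnegative and one ordered pair of the sum weighted by 1/4 is retained, hence the
    factor 4, which also covers leader edges. *)
Lemma energy_edge v eta (j : 'I_N.+1) i : E j (lift ord0 i) ->
  dot (eta i - nodeval v eta j) (eta i - nodeval v eta j) <= 4 * energy v eta.
Proof.
pose f i := \sum_j adj i j * dot (eta i - eta j) (eta i - eta j).
pose g i := lead i * dot (eta i - v) (eta i - v).
have f00 i' j' : 0 <= adj i' j' * dot (eta i' - eta j') (eta i' - eta j').
  by rewrite mulr_ge0 ?dot_ge0.
have f0 k : 0 <= f k by apply: sumr_ge0 => ? _.
have g0 k : 0 <= g k by rewrite mulr_ge0 ?dot_ge0.
have sf : 0 <= \sum_k f k by apply: sumr_ge0 => ? _.
have sg : 0 <= \sum_k g k by apply: sumr_ge0 => ? _.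
have -> : energy v eta = 4^-1 * (\sum_k f k) + 2^-1 * (\sum_k g k) by [].
case: (unliftP ord0 j) => [j' ->|->] Eji.
  rewrite nodeval_lift; apply: le_trans (_ : f i <= _).
    apply: le_trans (_ : adj i j' * dot (eta i - eta j') (eta i - eta j') <= _).
      by rewrite /adj Eji mul1r.
    exact: (@ler_sum_term _ _ (fun j' => adj i j' * dot (eta i - eta j') (eta i - eta j'))).
  by have := @ler_sum_term _ _ f i f0; lra.
rewrite nodeval0; apply: le_trans (_ : g i <= _); first by rewrite /g /lead Eji mul1r.
by have := @ler_sum_term _ _ g i g0; lra.
Qed.

Hypothesis Etree : has_spanning_tree E ord0.

(** The triangle inequality along a tree path from the root. No tree edge enters the root, so each
    step ends at a follower, where the edge bound applies. *)
Lemma spanning_tree_bound v eta (d : R) : 0 <= d ->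
  (forall j i, E j (lift ord0 i) -> `|eta i - nodeval v eta j| <= d) ->
  forall i, `|eta i - v| <= N.+1%:R * d.
Proof.
move=> d0 hd i; have [T [TE [T0 [_ Tc]]]] := Etree.
have {}T0 j : ~~ T j ord0.
  apply/negP => Tj; have := card0_eq T0 j.
  by rewrite [X in X = _](_ : _ = true)//; apply/mem_set.
have step j k : T j k -> `|nodeval v eta k - nodeval v eta j| <= d.
  case: (unliftP ord0 k) => [k' ->|->] Tjk; last by have := T0 j; rewrite Tjk.
  by rewrite nodeval_lift; exact/hd/TE.
have pathb : forall p j, path T j p ->
    `|nodeval v eta (last j p) - nodeval v eta j| <= (size p)%:R * d.
  elim=> [|k p ih] j /=; first by rewrite subrr normr0 mul0r.
  move=> /andP[jk kp]; rewrite -(subrKA (nodeval v eta k)) (le_trans (ler_normD _ _))//.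
  by rewrite -natr1 mulrDl mul1r lerD ?ih ?step.
have /connectP[p Tp ip] := Tc (lift ord0 i).
(* Only a path without repetition has its length controlled, by the number [N.+1] of nodes. *)
case: (shortenP Tp) ip => p' Tp' up' _ ip; have := pathb _ _ Tp'.
rewrite -ip nodeval_lift nodeval0 => /le_trans; apply; rewrite ler_wpM2r// ler_nat.
have := max_card (mem (ord0 :: p')); rewrite (card_uniqP up') card_ord /=.
exact: ltnW.
Qed.

Lemma energy_bound v eta (r : R) : 0 <= r -> 4 * energy v eta <= r ^+ 2 ->
  forall i, `|eta i - v| <= N.+1%:R * r.
Proof.
move=> r0 hr; apply: spanning_tree_bound => // j i Eji.
by apply: norm_le_dot => //; apply: le_trans hr; exact: energy_edge.
Qed.

Lemma is_derive_energy (v : R -> 'cV[R]_m) (eta : 'I_N -> R -> 'cV[R]_m) (t : R) dv deta :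
  is_derive t 1 v dv -> (forall i, is_derive t 1 (eta i) (deta i)) ->
  is_derive t 1 (fun s => energy (v s) (eta ^~ s))
    (2^-1 * (\sum_i \sum_j (E (lift ord0 j) (lift ord0 i))%:R *
       dot (eta i t - eta j t) (deta i - deta j)) +
     \sum_i (E ord0 (lift ord0 i))%:R * dot (eta i t - v t) (deta i - dv)).
Proof.
move=> hv heta.
have hd (f g : R -> 'cV[R]_m) df dg : is_derive t 1 f df -> is_derive t 1 g dg ->
    is_derive t 1 (fun s => dot (f s - g s) (f s - g s)) (2 * dot (f t - g t) (df - dg)).
  move=> hf hg; have hfg := is_deriveB hf hg.
  apply: is_derive_eq (is_derive_dot hfg hfg) _.
  by rewrite dotC; ring.
have h1 : is_derive t 1
    (fun s => \sum_i \sum_j (E (lift ord0 j) (lift ord0 i))%:R *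
       dot (eta i s - eta j s) (eta i s - eta j s))
    (\sum_i \sum_j (E (lift ord0 j) (lift ord0 i))%:R *
       (2 * dot (eta i t - eta j t) (deta i - deta j))).
  by apply: is_derive_sumr => i; apply: is_derive_sumr => j; apply: is_derive_cstM; apply: (hd).
have h2 : is_derive t 1
    (fun s => \sum_i (E ord0 (lift ord0 i))%:R * dot (eta i s - v s) (eta i s - v s))
    (\sum_i (E ord0 (lift ord0 i))%:R * (2 * dot (eta i t - v t) (deta i - dv))).
  by apply: is_derive_sumr => i; apply: is_derive_cstM; apply: (hd).
apply: is_derive_eq (is_deriveD (is_derive_cstM _ h1) (is_derive_cstM _ h2)) _.
rewrite mulr_sumr mulr_sumr [in RHS]mulr_sumr; congr (_ + _); apply: eq_bigr => i _.
  rewrite !mulr_sumr; apply: eq_bigr => j _.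
  by field.
by field.
Qed.

(* The common rotation [S] of the node values does not change the energy, since
   [S] is skew. *)
Lemma is_derive_energy_rotation (v : R -> 'cV[R]_m) (eta : 'I_N -> R -> 'cV[R]_m) (t c : R)
    (S : 'M[R]_m) u : S^T = - S ->
  is_derive t 1 v (c *: (S *m v t)) ->
  (forall i, is_derive t 1 (eta i) (c *: (S *m eta i t + u i))) ->
  is_derive t 1 (fun s => energy (v s) (eta ^~ s))
    (c * - \sum_i dot (disagreement (v t) (eta ^~ t) i) (u i)).
Proof.
move=> Sskew hv heta; apply: is_derive_eq (is_derive_energy hv heta) _.
have skew (x y z w : 'cV[R]_m) :
    dot (x - y) (c *: (S *m x + z) - c *: (S *m y + w)) = c * dot (x - y) (z - w).
  by rewrite -scalerBr dotZr opprD addrACA -mulmxBr (dotDr _ (S *m (x - y))) dot_skew// add0r.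
rewrite sum_disagreement opprK mulrDr mulrCA !mulr_sumr; congr (_ + _).
  apply: eq_bigr => i _; rewrite !mulr_sumr; apply: eq_bigr => j _.
  by rewrite skew; ring.
apply: eq_bigr => i _; rewrite -(addr0 (S *m v t)) skew subr0.
by ring.
Qed.

End graph_energy.

(** * The closed-loop system *)

Section columns.
Context {R : realType}.

(** The vectors of all followers are the columns of one matrix, which makes the state a finite
    product of matrix spaces. *)
Definition cols m n (f : 'I_n -> 'cV[R]_m) : 'M[R]_(m, n) := \matrix_(r, c) f c r ord0.

Lemma col_cols m n (f : 'I_n -> 'cV[R]_m) i : col i (cols f) = f i.
Proof. by apply/matrixP => r c; rewrite !mxE (ord1 c). Qed.

Lemma cvg_cols (T : Type) (F : set_system T) {FF : Filter F} m n
    (f : T -> 'I_n -> 'cV[R]_m) (a : 'I_n -> 'cV[R]_m) :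
  (forall i, f x i @[x --> F] --> a i) -> cols (f x) @[x --> F] --> cols a.
Proof.
move=> fa; apply/cvg_mxP => r c; under eq_fun do rewrite mxE; rewrite mxE.
by have /cvg_mxP := fa c; exact.
Qed.

Lemma cvg_col (T : Type) (F : set_system T) {FF : Filter F} m n
    (A : T -> 'M[R]_(m, n)) (a : 'M[R]_(m, n)) i :
  A x @[x --> F] --> a -> col i (A x) @[x --> F] --> col i a.
Proof.
move=> /cvg_mxP Aa; apply/cvg_mxP => r c.
by under eq_fun do rewrite mxE; rewrite mxE; exact: Aa.
Qed.

Lemma is_derive_col m n (A : R -> 'M[R]_(m, n)) (t : R) dA i :
  is_derive t 1 A dA -> is_derive t 1 (fun s => col i (A s)) (col i dA).
Proof.
move=> /is_derive_mxP hA; apply/is_derive_mxP => r c.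
by under eq_fun do rewrite mxE; rewrite mxE; exact: hA.
Qed.

Lemma is_derive_cols m n (f : R -> 'I_n -> 'cV[R]_m) (t : R) df :
  (forall i, is_derive t 1 (f ^~ i) (df i)) ->
  is_derive t 1 (fun s => cols (f s)) (cols df).
Proof.
move=> hf; apply/is_derive_mxP => r c; under eq_fun do rewrite mxE; rewrite mxE.
by have /is_derive_mxP := hf c; exact.
Qed.

Lemma norm_col_le m n (A : 'M[R]_(m, n)) i : `|col i A| <= `|A|.
Proof. by apply/mx_norm_leP; split=> // r c; rewrite mxE ler_mx_entry. Qed.

End columns.

Section multi_agent_system.
Context {R : realType} (N n p l : nat)
  (M : 'I_N -> 'cV[R]_n -> 'M[R]_n)
  (Cm : 'I_N -> 'cV[R]_n -> 'cV[R]_n -> 'M[R]_n)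
  (G : 'I_N -> 'cV[R]_n -> 'cV[R]_n)
  (Y : 'I_N -> 'cV[R]_n -> 'cV[R]_n -> 'cV[R]_n -> 'cV[R]_n -> 'M[R]_(n, p))
  (Theta : 'I_N -> 'cV[R]_p)
  (Cout : 'M[R]_(n, l * 2)) (om0 : 'cV[R]_l) (E : rel 'I_N.+1)
  (alpha mu1 mu2 : R) (K : 'I_N -> 'M[R]_n) (Lam : 'I_N -> 'M[R]_p).

Definition state : normedModType R :=
  ('cV[R]_(l * 2) * 'M[R]_(n, N) * 'M[R]_(n, N) * 'M[R]_(l * 2, N) * 'M[R]_(l, N) *
   'M[R]_(p, N))%type.

Implicit Types (x : state) (i : 'I_N).

Definition st_v x : 'cV[R]_(l * 2) := x.1.1.1.1.1.
Definition st_q i x : 'cV[R]_n := col i x.1.1.1.1.2.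
Definition st_qd i x : 'cV[R]_n := col i x.1.1.1.2.
Definition st_eta i x : 'cV[R]_(l * 2) := col i x.1.1.2.
Definition st_om i x : 'cV[R]_l := col i x.1.2.
Definition st_th i x : 'cV[R]_p := col i x.2.

Definition mk_state v (q qd : 'I_N -> 'cV[R]_n) eta om th : state :=
  (v, cols q, cols qd, cols eta, cols om, cols th).

Definition st_ev i x := disagreement E (st_v x) (st_eta ^~ x) i.
Definition st_etad i x := Smat (st_om i x) *m st_eta i x + mu1 *: st_ev i x.
Definition st_omd i x := mu2 *: (phi (st_ev i x) *m st_eta i x).
Definition st_qdr i x :=
  Cout *m Smat (st_om i x) *m st_eta i x - alpha *: (st_q i x - Cout *m st_eta i x).
Definition st_s i x := st_qd i x - st_qdr i x.
Definition st_qddr i x :=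
  Cout *m Smat (st_om i x) *m st_etad i x + Cout *m Smat (st_omd i x) *m st_eta i x
  - alpha *: (st_qd i x - Cout *m st_etad i x).
Definition st_Y i x := Y i (st_q i x) (st_qd i x) (st_qddr i x) (st_qdr i x).
Definition st_tau i x := - (K i *m st_s i x) + st_Y i x *m st_th i x.
(** The acceleration solved from the Euler-Lagrange equation, so that the closed loop becomes an
    explicit vector field; coercivity of [M i] makes the inverse genuine. *)
Definition st_acc i x := invmx (M i (st_q i x)) *m
  (st_tau i x - Cm i (st_q i x) (st_qd i x) *m st_qd i x - G i (st_q i x)).
Definition st_thd i x := - (invmx (Lam i) *m ((st_Y i x)^T *m st_s i x)).
Definition st_e i x := st_q i x - Cout *m st_eta i x.

Definition field x : state :=
  mk_state (Smat om0 *m st_v x) (st_qd ^~ x) (st_acc ^~ x) (st_etad ^~ x) (st_omd ^~ x)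
    (st_thd ^~ x).

(** * Compact balls of states and continuity of the vector field *)

Lemma proper_state : proper_space state.
Proof.
by do 5?[apply: proper_space_prod; last exact: proper_space_mx]; exact: proper_space_mx.
Qed.

Let continuous_fst (T : topologicalType) (U W : normedModType R) (f : T -> U * W) :
  continuous f -> continuous (fun y : T => (f y).1).
Proof.
by move=> fc x; exact: (cvg_comp _ (@fst U W) (fc x)
  (@cvg_fst _ _ (nbhs (f x).1) (nbhs (f x).2) _)).
Qed.

Let continuous_snd (T : topologicalType) (U W : normedModType R) (f : T -> U * W) :
  continuous f -> continuous (fun y : T => (f y).2).
Proof.
by move=> fc x; exact: (cvg_comp _ (@snd U W) (fc x)
  (@cvg_snd _ _ (nbhs (f x).1) (nbhs (f x).2) _)).
Qed.

Let continuous_pair (T : topologicalType) (U W : normedModType R) (f : T -> U) (g : T -> W) :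
  continuous f -> continuous g -> continuous (fun y : T => (f y, g y)).
Proof. by move=> fc gc y; apply: cvg_pair; [exact: fc|exact: gc]. Qed.

Let continuous_id : continuous (fun x : state => x).
Proof. by move=> x; exact: cvg_id. Qed.

Lemma continuous_st_v : continuous st_v.
Proof. by do 5!apply: continuous_fst; exact: continuous_id. Qed.

Lemma continuous_st_q i : continuous (st_q i).
Proof.
move=> x; apply: cvg_col; apply: (continuous_snd (f := fun x : state => x.1.1.1.1)).
by do 4!apply: continuous_fst; exact: continuous_id.
Qed.

Lemma continuous_st_qd i : continuous (st_qd i).
Proof.
move=> x; apply: cvg_col; apply: (continuous_snd (f := fun x : state => x.1.1.1)).
by do 3!apply: continuous_fst; exact: continuous_id.
Qed.

Lemma continuous_st_eta i : continuous (st_eta i).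
Proof.
move=> x; apply: cvg_col; apply: (continuous_snd (f := fun x : state => x.1.1)).
by do 2!apply: continuous_fst; exact: continuous_id.
Qed.

Lemma continuous_st_om i : continuous (st_om i).
Proof.
move=> x; apply: cvg_col; apply: (continuous_snd (f := fun x : state => x.1)).
by do 1!apply: continuous_fst; exact: continuous_id.
Qed.

Lemma continuous_st_th i : continuous (st_th i).
Proof.
move=> x; apply: cvg_col; apply: (continuous_snd (f := fun x : state => x)).
exact: continuous_id.
Qed.

Lemma continuous_st_ev i : continuous (st_ev i).
Proof.
move=> x; apply: cvg_sumr => j; apply: cvgB; last exact: continuous_st_eta.
case: (unliftP ord0 j) => [k ->|->].
  under eq_fun do rewrite nodeval_lift; rewrite nodeval_lift.
  exact: continuous_st_eta.
under eq_fun do rewrite nodeval0; rewrite nodeval0.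
exact: continuous_st_v.
Qed.

Let cvg_mulmxr (T : Type) (F : set_system T) {FF : Filter F} a b c (A : 'M[R]_(a, b))
    (f : T -> 'M[R]_(b, c)) (y : 'M[R]_(b, c)) :
  f z @[z --> F] --> y -> A *m f z @[z --> F] --> A *m y.
Proof. by move=> h; apply: cvg_mulmx => //; exact: cvg_cst. Qed.

Let cvgZ_cst (T : Type) (F : set_system T) {FF : Filter F} a b (c : R)
    (f : T -> 'M[R]_(a, b)) (y : 'M[R]_(a, b)) :
  f z @[z --> F] --> y -> c *: f z @[z --> F] --> c *: y.
Proof. by move=> h; apply: cvgZ => //; exact: cvg_cst. Qed.

Lemma continuous_st_etad i : continuous (st_etad i).
Proof.
move=> x; apply: cvgD; last by apply: cvgZ_cst; exact: continuous_st_ev.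
by apply: cvg_mulmx; [apply: cvg_Smat; exact: continuous_st_om|exact: continuous_st_eta].
Qed.

Lemma continuous_st_omd i : continuous (st_omd i).
Proof.
move=> x; apply: cvgZ_cst; apply: cvg_mulmx; last exact: continuous_st_eta.
by apply: cvg_phi; exact: continuous_st_ev.
Qed.

Lemma continuous_st_e i : continuous (st_e i).
Proof.
move=> x; apply: cvgB; first exact: continuous_st_q.
by apply: cvg_mulmxr; exact: continuous_st_eta.
Qed.

Lemma continuous_st_qdr i : continuous (st_qdr i).
Proof.
move=> x; apply: cvgB; last by apply: cvgZ_cst; exact: continuous_st_e.
apply: cvg_mulmx; last exact: continuous_st_eta.
by apply: cvg_mulmxr; apply: cvg_Smat; exact: continuous_st_om.
Qed.

Lemma continuous_st_s i : continuous (st_s i).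
Proof. by move=> x; apply: cvgB; [exact: continuous_st_qd|exact: continuous_st_qdr]. Qed.

Lemma continuous_st_qddr i : continuous (st_qddr i).
Proof.
move=> x; apply: cvgB; last first.
  apply: cvgZ_cst; apply: cvgB; first exact: continuous_st_qd.
  by apply: cvg_mulmxr; exact: continuous_st_etad.
apply: cvgD; apply: cvg_mulmx; try by [exact: continuous_st_eta|exact: continuous_st_etad].
- by apply: cvg_mulmxr; apply: cvg_Smat; exact: continuous_st_om.
- by apply: cvg_mulmxr; apply: cvg_Smat; exact: continuous_st_omd.
Qed.

Hypothesis Mdiff : forall i q, differentiable (M i) q.
Hypothesis Ccont : forall i, continuous (fun z : 'cV[R]_n * 'cV[R]_n => Cm i z.1 z.2).
Hypothesis Gcont : forall i, continuous (G i).
Hypothesis Ycont : forall i, continuous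
  (fun z : 'cV[R]_n * 'cV[R]_n * 'cV[R]_n * 'cV[R]_n => Y i z.1.1.1 z.1.1.2 z.1.2 z.2).
Hypothesis Mpos : forall i, exists2 c : R, 0 < c &
  forall q (x : 'cV[R]_n), c * dot x x <= dot x (M i q *m x).

Lemma unitmx_M i q : M i q \in unitmx.
Proof.
apply: unitmx_dot => x x0; have [c c0 hc] := Mpos i.
apply: lt_le_trans (hc q x); rewrite mulr_gt0// lt_neqAle dot_ge0 andbT eq_sym.
apply: contraNneq x0 => xx; apply/eqP/normr0_eq0/eqP; rewrite eq_le normr_ge0 andbT.
by apply: norm_le_dot; rewrite ?xx ?expr0n.
Qed.

Lemma continuous_st_Y i : continuous (st_Y i).
Proof.
have h : continuous (fun x => (st_q i x, st_qd i x, st_qddr i x, st_qdr i x)).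
  apply: continuous_pair; last exact: continuous_st_qdr.
  apply: continuous_pair; last exact: continuous_st_qddr.
  by apply: continuous_pair; [exact: continuous_st_q|exact: continuous_st_qd].
by move=> x; exact: (cvg_comp _ _ (h x) (@Ycont i _)).
Qed.

Lemma continuous_st_acc i : continuous (st_acc i).
Proof.
move=> x; apply: cvg_mulmx.
  apply: cvg_invmx; [by move=> y; exact: unitmx_M|exact: unitmx_M|].
  apply: (cvg_comp _ _ (@continuous_st_q i x)).
  exact: differentiable_continuous (Mdiff i _).
apply: cvgB; last by apply: (cvg_comp _ _ (@continuous_st_q i x)); exact: Gcont.
apply: cvgB.
  apply: cvgD; first by apply: cvgN; apply: cvg_mulmxr; exact: continuous_st_s.
  by apply: cvg_mulmx; [exact: continuous_st_Y|exact: continuous_st_th].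
apply: cvg_mulmx; last exact: continuous_st_qd.
have h : continuous (fun x => (st_q i x, st_qd i x)).
  by apply: continuous_pair; [exact: continuous_st_q|exact: continuous_st_qd].
exact: (cvg_comp _ _ (h x) (@Ccont i _)).
Qed.

Lemma continuous_st_thd i : continuous (st_thd i).
Proof.
move=> x; apply: cvgN; apply: cvg_mulmxr; apply: cvg_mulmx; last exact: continuous_st_s.
by apply: cvg_trmx; exact: continuous_st_Y.
Qed.

Lemma continuous_field : continuous field.
Proof.
apply: continuous_pair; last by move=> x; apply: cvg_cols => i; exact: continuous_st_thd.
apply: continuous_pair; last by move=> x; apply: cvg_cols => i; exact: continuous_st_omd.
apply: continuous_pair; last by move=> x; apply: cvg_cols => i; exact: continuous_st_etad.
apply: continuous_pair; last by move=> x; apply: cvg_cols => i; exact: continuous_st_acc.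
apply: continuous_pair; last by move=> x; apply: cvg_cols => i; exact: continuous_st_qd.
by move=> x; apply: cvg_mulmxr; exact: continuous_st_v.
Qed.

Let fstZ (U W : normedModType R) (c : R) (z : U * W) : (c *: z).1 = c *: z.1.
Proof. by []. Qed.

Let sndZ (U W : normedModType R) (c : R) (z : U * W) : (c *: z).2 = c *: z.2.
Proof. by []. Qed.

Let colZ a b (c : R) (A : 'M[R]_(a, b)) j : col j (c *: A) = c *: col j A.
Proof. exact: linearZ. Qed.

Lemma st_v_field x : st_v (field x) = Smat om0 *m st_v x.
Proof. by []. Qed.

Lemma st_vZ c x : st_v (c *: x) = c *: st_v x.
Proof. by case: x => -[[[[]]]]. Qed.

(** * Lyapunov functions and the dissipation inequality *)

Definition st_V x := energy E (st_v x) (st_eta ^~ x) +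
  mu2^-1 * \sum_i (2^-1 * dot (st_om i x - om0) (st_om i x - om0)).

Definition st_W i x := 2^-1 * dot (st_s i x) (M i (st_q i x) *m st_s i x) +
  2^-1 * dot (st_th i x - Theta i) (Lam i *m (st_th i x - Theta i)).

Hypothesis Eundirected : forall i j : 'I_N,
  E (lift ord0 i) (lift ord0 j) = E (lift ord0 j) (lift ord0 i).
Hypothesis mu2_gt0 : 0 < mu2.

Hypothesis Msym : forall i q, (M i q)^T = M i q.
Hypothesis Yparam : forall i q qd a b,
  M i q *m a + Cm i q qd *m b + G i q = Y i q qd a b *m Theta i.
Hypothesis Cskew : forall i q qd,
  ('d (M i) q qd - 2%:R *: Cm i q qd)^T = - ('d (M i) q qd - 2%:R *: Cm i q qd).
Hypothesis Lam_diag : forall i, is_diag_mx (Lam i).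
Hypothesis Lam_pos : forall i k, 0 < Lam i k k.

Lemma Lam_sym i : (Lam i)^T = Lam i.
Proof. by have /diag_mxP[d ->] := Lam_diag i; rewrite tr_diag_mx. Qed.

Lemma Lam_unit i : Lam i \in unitmx.
Proof.
have /diag_mxP[d dE] := Lam_diag i; rewrite dE unitmxE det_diag unitfE.
apply/prodf_neq0 => k _; have := Lam_pos i k; rewrite dE mxE eqxx mulr1n.
by move=> /gt_eqF ->.
Qed.

(** The parametrisation at [(qddr, qdr)] is subtracted from the equation of motion: gravity cancels,
    and only the parameter error multiplies the regressor. *)
Lemma error_dynamics i x : M i (st_q i x) *m (st_acc i x - st_qddr i x) =
  - (K i *m st_s i x) + st_Y i x *m (st_th i x - Theta i) -
  Cm i (st_q i x) (st_qd i x) *m st_s i x.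
Proof.
rewrite mulmxBr mulKVmx ?unitmx_M// [st_Y i x *m (_ - _)]mulmxBr -Yparam /st_tau /st_s.
rewrite (mulmxBr (Cm i _ _) (st_qd i x)).
move: (K i *m _) (_ *m st_th i x) (Cm i _ _ *m st_qd i x) (Cm i _ _ *m st_qdr i x) (G i _)
  (M i _ *m _) => a b d e f g.
by apply/matrixP => r k; rewrite !mxE; ring.
Qed.

Hypothesis Etree : has_spanning_tree E ord0.
Hypothesis alpha_gt0 : 0 < alpha.
Hypothesis mu1_gt0 : 0 < mu1.
Context (kap : 'I_N -> R) (cC : R).
Hypothesis kap_gt0 : forall i, 0 < kap i.
Hypothesis Kcoercive : forall i (y : 'cV[R]_n), kap i * dot y y <= dot y (K i *m y).
Hypothesis cC_ge0 : 0 <= cC.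
Hypothesis Cbound : forall y, dot (Cout *m y) (Cout *m y) <= cC * dot y y.

(* The weights make the cross terms [e . s] and [e . C ev] of the derivative of
   [|e|^2 / 2] absorbable (by Young's inequality) in the dissipation of [st_W] and [st_V]. *)
Definition gam i := (alpha^-1 + 1) / kap i.
Definition bet := mu1 * cC / alpha + mu1^-1.

Definition st_U x := bet * st_V x +
  \sum_i (2^-1 * dot (st_e i x) (st_e i x) + gam i * st_W i x).

Definition st_Ud x := bet * - (mu1 * \sum_i dot (st_ev i x) (st_ev i x)) +
  \sum_i (dot (st_e i x) (st_s i x - alpha *: st_e i x - mu1 *: (Cout *m st_ev i x)) +
    gam i * - dot (st_s i x) (K i *m st_s i x)).

Lemma gam_gt0 i : 0 < gam i.
Proof. by rewrite divr_gt0// addr_gt0 ?invr_gt0. Qed.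

Lemma bet_gt0 : 0 < bet.
Proof. by rewrite ltr_wpDl ?invr_gt0// divr_ge0 ?mulr_ge0// ltW. Qed.

Lemma st_Ud_le x : st_Ud x <= - \sum_i (alpha / 2 * dot (st_e i x) (st_e i x) +
  dot (st_s i x) (st_s i x) + dot (st_ev i x) (st_ev i x)).
Proof.
rewrite /st_Ud mulr_sumr -sumrN mulr_sumr -big_split/= -sumrN; apply: ler_sum => i _.
set e := st_e i x; set s := st_s i x; set ev := st_ev i x.
(* Young's inequality with weight [alpha / 4] on both cross terms spends half of [alpha |e|^2], at
   the price [alpha^-1] times the square of the other factor. *)
have a4 : 0 < alpha / 4 by rewrite divr_gt0.
have a4E : (4 * (alpha / 4))^-1 = alpha^-1 by rewrite mulrC divfK.
have h1 := dot_young e s a4; have h2 := dot_young e (- (mu1 *: (Cout *m ev))) a4.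
have h3 := Cbound ev; have h4 := Kcoercive i s.
rewrite a4E in h1 h2; move: h2; rewrite !(dotNr, dotNl) opprK !(dotZr, dotZl) => h2.
have h5 : (alpha^-1 + 1) * dot s s <= gam i * dot s (K i *m s).
  rewrite /gam -mulrA ler_wpM2l ?addr_ge0 ?invr_ge0 ?(ltW alpha_gt0)//.
  by rewrite mulrC ler_pdivlMr// mulrC.
have h6 : alpha^-1 * (mu1 * (mu1 * dot (Cout *m ev) (Cout *m ev))) <=
    (bet * mu1 - 1) * dot ev ev.
  (* [bet] is chosen to make this exact: one unit of [|ev|^2] survives and the rest pays for the
     cross term with [Cout]. *)
  have -> : bet * mu1 - 1 = alpha^-1 * mu1 * mu1 * cC.
    by rewrite /bet; field; rewrite !gt_eqF.
  rewrite !mulrA -[leRHS]mulrA ler_wpM2l// !mulr_ge0 ?invr_ge0// ltW//.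
clearbody e s ev; rewrite !dotBr !dotZr.
by lra.
Qed.

(** * Derivatives along [X' = c *: field X]: the factor serves both the cut-off field and the field
    itself *)

Section derivatives.
Context (X : R -> state) (t c : R).
Hypothesis Xder : is_derive t 1 X (c *: field (X t)).

Lemma is_derive_st_v : is_derive t 1 (fun s => st_v (X s)) (c *: (Smat om0 *m st_v (X t))).
Proof.
rewrite -st_v_field -st_vZ.
exact: (is_derive_fst (is_derive_fst (is_derive_fst (is_derive_fst (is_derive_fst Xder))))).
Qed.

Lemma is_derive_st_q i : is_derive t 1 (fun s => st_q i (X s)) (c *: st_qd i (X t)).
Proof.
have -> : c *: st_qd i (X t) = st_q i (c *: field (X t)).
  by rewrite /st_q !fstZ sndZ colZ col_cols.
exact: (is_derive_col i (is_derive_snd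
  (is_derive_fst (is_derive_fst (is_derive_fst (is_derive_fst Xder)))))).
Qed.

Lemma is_derive_st_qd i : is_derive t 1 (fun s => st_qd i (X s)) (c *: st_acc i (X t)).
Proof.
have -> : c *: st_acc i (X t) = st_qd i (c *: field (X t)).
  by rewrite /st_qd !fstZ sndZ colZ col_cols.
exact: (is_derive_col i (is_derive_snd (is_derive_fst (is_derive_fst (is_derive_fst Xder))))).
Qed.

Lemma is_derive_st_eta i : is_derive t 1 (fun s => st_eta i (X s)) (c *: st_etad i (X t)).
Proof.
have -> : c *: st_etad i (X t) = st_eta i (c *: field (X t)).
  by rewrite /st_eta !fstZ sndZ colZ col_cols.
exact: (is_derive_col i (is_derive_snd (is_derive_fst (is_derive_fst Xder)))).
Qed.

Lemma is_derive_st_om i : is_derive t 1 (fun s => st_om i (X s)) (c *: st_omd i (X t)).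
Proof.
have -> : c *: st_omd i (X t) = st_om i (c *: field (X t)).
  by rewrite /st_om !fstZ sndZ colZ col_cols.
exact: (is_derive_col i (is_derive_snd (is_derive_fst Xder))).
Qed.

Lemma is_derive_st_th i : is_derive t 1 (fun s => st_th i (X s)) (c *: st_thd i (X t)).
Proof.
have -> : c *: st_thd i (X t) = st_th i (c *: field (X t)).
  by rewrite /st_th sndZ colZ col_cols.
exact: (is_derive_col i (is_derive_snd Xder)).
Qed.

Lemma is_derive_st_e i : is_derive t 1 (fun s => st_e i (X s))
  (c *: (st_s i (X t) - alpha *: st_e i (X t) - mu1 *: (Cout *m st_ev i (X t)))).
Proof.
apply: is_derive_eq (is_deriveB (is_derive_st_q i) (is_derive_mulmxr Cout (is_derive_st_eta i))) _.
rewrite -scalemxAr -scalerBr; congr (_ *: _).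
rewrite /st_s /st_qdr -/(st_e i _) /st_etad mulmxDr -scalemxAr mulmxA.
move: (_ *m st_eta i _) (st_qd i _) (alpha *: _) (mu1 *: _) => a b d e.
by apply/matrixP => r k; rewrite !mxE; ring.
Qed.

Lemma is_derive_st_qdr i : is_derive t 1 (fun s => st_qdr i (X s)) (c *: st_qddr i (X t)).
Proof.
apply: is_derive_eq.
  apply: is_deriveB.
    apply: is_derive_mulmx (is_derive_st_eta i).
    exact: is_derive_mulmxr (is_derive_Smat (is_derive_st_om i)).
  apply: is_deriveZ; apply: is_deriveB (is_derive_st_q i) _.
  exact: is_derive_mulmxr (is_derive_st_eta i).
rewrite SmatZ -!scalemxAr -scalemxAl -scalerDr -scalerBr scalerA (mulrC alpha) -scalerA.
by rewrite -scalerBr /st_qddr; congr (_ *: (_ - _)); exact: addrC.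
Qed.

Lemma is_derive_st_s i : is_derive t 1 (fun s => st_s i (X s))
  (c *: (st_acc i (X t) - st_qddr i (X t))).
Proof.
apply: is_derive_eq (is_deriveB (is_derive_st_qd i) (is_derive_st_qdr i)) _.
by rewrite -scalerBr.
Qed.

(** Relative to the common rotation [Smat om0], follower [i] has residual velocity
    [S(om_i - om0) eta_i + mu1 ev_i]. The first part cancels, through [dot_phi], against the
    derivative of the frequency errors; the second is the dissipation. *)
Lemma is_derive_st_V : is_derive t 1 (fun s => st_V (X s))
  (c * - (mu1 * \sum_i dot (st_ev i (X t)) (st_ev i (X t)))).
Proof.
have hV : is_derive t 1 (fun s => energy E (st_v (X s)) (fun i => st_eta i (X s)))
    (c * - \sum_i dot (st_ev i (X t))
      (Smat (st_om i (X t) - om0) *m st_eta i (X t) + mu1 *: st_ev i (X t))).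
  apply: (@is_derive_energy_rotation _ _ _ E Eundirected (fun s => st_v (X s))
    (fun i s => st_eta i (X s)) t c (Smat om0)).
  - exact: Smat_skew.
  - exact: is_derive_st_v.
  - move=> i; apply: is_derive_eq (is_derive_st_eta i) _; congr (_ *: _).
    by rewrite /st_etad SmatB mulmxBl addrA [Smat om0 *m _ + _]addrC subrK.
have hO i : is_derive t 1 (fun s => 2^-1 * dot (st_om i (X s) - om0) (st_om i (X s) - om0))
    (c * (mu2 * dot (st_ev i (X t)) (Smat (st_om i (X t) - om0) *m st_eta i (X t)))).
  have := is_derive_sqdot (is_deriveB (is_derive_st_om i) (is_derive_cst om0 _ _)).
  move=> h; apply: is_derive_eq h _.
  by rewrite subr0 dotZr /st_omd dotZr dot_phi.
apply: is_derive_eq (is_deriveD hV (is_derive_cstM mu2^-1 (is_derive_sumr xpredT hO))) _.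
have -> F : \sum_i c * (mu2 * F i) = c * (mu2 * \sum_(i < N) F i) by rewrite !mulr_sumr.
rewrite mulrCA mulKf ?gt_eqF// -mulrDr; congr (_ * _).
rewrite -sumrN -big_split/= mulr_sumr -sumrN; apply: eq_bigr => i _.
by rewrite dotDr dotZr; ring.
Qed.

(** Two cancellations: skewness of ['d (M i) q qd - 2 Cm] removes the Coriolis term against half the
    rate of the inertia ([hC]), and the parameter update removes the regressor term ([hL]). Only the
    damping by [K i] remains. *)
Lemma is_derive_st_W i : is_derive t 1 (fun s => st_W i (X s))
  (c * - dot (st_s i (X t)) (K i *m st_s i (X t))).
Proof.
have hM := is_derive_comp (Mdiff i (st_q i (X t))) (is_derive_st_q i).
have hs := is_derive_st_s i.
have hth : is_derive t 1 (fun s => st_th i (X s) - Theta i) (c *: st_thd i (X t)).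
  apply: is_derive_eq (is_deriveB (is_derive_st_th i) (is_derive_cst (Theta i) _ _)) _.
  by rewrite subr0.
have h1 := is_derive_dot hs (is_derive_mulmx hM hs).
have h2 := is_derive_dot hth (is_derive_mulmxr (Lam i) hth).
apply: is_derive_eq (is_deriveD (is_derive_cstM 2^-1 h1) (is_derive_cstM 2^-1 h2)) _.
(* The differential of [M i] is evaluated at [c *: qd]; linearity brings out the time factor. *)
rewrite linearZ/=.
set s := st_s i (X t); set q := st_q i (X t); set qd := st_qd i (X t).
set D := 'd (M i) q qd; set ds := st_acc i (X t) - _; set dth := st_thd i (X t).
set w := st_th i (X t) - Theta i.
have hC : dot s (D *m s) = 2 * dot s (Cm i q qd *m s).
  have := dot_skew s (Cskew i q qd); rewrite mulmxBl dotBr -scalemxAl dotZr => h.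
  by apply/eqP; rewrite -subr_eq0; apply/eqP.
have hMs : dot s (M i q *m ds) =
    - dot s (K i *m s) + dot s (st_Y i (X t) *m w) - dot s (Cm i q qd *m s).
  by rewrite error_dynamics dotBr dotDr dotNr.
have hL : dot w (Lam i *m dth) = - dot s (st_Y i (X t) *m w).
  by rewrite /dth /st_thd mulmxN mulKVmx ?Lam_unit// dotNr [in RHS]dot_mulmxr dotC.
clearbody D ds dth w s q qd.
rewrite -scalemxAl -!scalemxAr dotDr !dotZr !dotZl.
rewrite (dot_mulmxr _ dth) Lam_sym (dotC _ w) hL (dot_mulmxr _ ds) Msym (dotC _ s) hMs hC.
by field.
Qed.

Lemma is_derive_st_U : is_derive t 1 (fun s => st_U (X s)) (c * st_Ud (X t)).
Proof.
have hi i : is_derive t 1 (fun s => 2^-1 * dot (st_e i (X s)) (st_e i (X s)) +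
    gam i * st_W i (X s))
    (c * (dot (st_e i (X t)) (st_s i (X t) - alpha *: st_e i (X t) -
       mu1 *: (Cout *m st_ev i (X t))) +
     gam i * - dot (st_s i (X t)) (K i *m st_s i (X t)))).
  apply: is_derive_eq (is_deriveD (is_derive_sqdot (is_derive_st_e i))
    (is_derive_cstM (gam i) (is_derive_st_W i))) _.
  by rewrite dotZr mulrDr [gam i * (c * _)]mulrCA.
apply: is_derive_eq (is_deriveD (is_derive_cstM bet is_derive_st_V) (is_derive_sumr xpredT hi)) _.
by rewrite -mulr_sumr [bet * (c * _)]mulrCA -mulrDr.
Qed.

End derivatives.

(** * Lower bounds on the Lyapunov function and bounded sublevel sets *)

Let dot_LamE i (w : 'cV[R]_p) : dot w (Lam i *m w) = \sum_k Lam i k k * (w k ord0 * w k ord0).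
Proof.
have /diag_mxP[d dE] := Lam_diag i; apply: eq_bigr => k _; rewrite dE mul_diag_mx !mxE.
by rewrite eqxx mulr1n mulrCA.
Qed.

Let Lam_term_ge0 i (w : 'cV[R]_p) k : 0 <= Lam i k k * (w k ord0 * w k ord0).
Proof. by rewrite mulr_ge0 ?(ltW (Lam_pos _ _))// -expr2 sqr_ge0. Qed.

Lemma dot_Lam_ge0 i (w : 'cV[R]_p) : 0 <= dot w (Lam i *m w).
Proof. by rewrite dot_LamE; apply: sumr_ge0 => k _; exact: Lam_term_ge0. Qed.

Lemma dot_Lam_le i (w : 'cV[R]_p) :
  dot w w <= (\sum_k (Lam i k k)^-1) * dot w (Lam i *m w).
Proof.
rewrite mulr_suml; apply: ler_sum => k _.
rewrite ler_pdivlMl// dot_LamE.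
exact: (@ler_sum_term _ _ (fun k => Lam i k k * (w k ord0 * w k ord0))).
Qed.

Lemma st_W_ge0 i x : 0 <= st_W i x.
Proof.
have [a a0 ha] := Mpos i.
have h1 := ha (st_q i x) (st_s i x); have h2 := dot_ge0 (st_s i x).
have h3 := dot_Lam_ge0 i (st_th i x - Theta i).
have h4 : 0 <= dot (st_s i x) (M i (st_q i x) *m st_s i x).
  by apply: le_trans h1; rewrite mulr_ge0// ltW.
by rewrite /st_W; lra.
Qed.

Lemma st_V_ge0 x : 0 <= st_V x.
Proof.
rewrite addr_ge0 ?energy_ge0// mulr_ge0 ?invr_ge0 ?(ltW mu2_gt0)//.
by apply: sumr_ge0 => i _; rewrite mulr_ge0 ?invr_ge0 ?dot_ge0.
Qed.

Let st_U_term_ge0 x i : 0 <= 2^-1 * dot (st_e i x) (st_e i x) + gam i * st_W i x.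
Proof.
apply: addr_ge0; apply: mulr_ge0; rewrite ?invr_ge0 ?dot_ge0 ?st_W_ge0//.
exact: ltW (gam_gt0 i).
Qed.

Lemma st_U_ge0 x : 0 <= st_U x.
Proof.
rewrite addr_ge0 ?mulr_ge0 ?st_V_ge0 ?(ltW bet_gt0)//.
by apply: sumr_ge0 => i _; exact: st_U_term_ge0.
Qed.

Lemma st_V_le_U x : st_V x <= st_U x / bet.
Proof.
rewrite ler_pdivlMr ?bet_gt0// mulrC lerDl.
by apply: sumr_ge0 => i _; exact: st_U_term_ge0.
Qed.

Let st_term_le_U x i : 2^-1 * dot (st_e i x) (st_e i x) + gam i * st_W i x <= st_U x.
Proof.
apply: le_trans (@ler_sum_term _ _ _ i (st_U_term_ge0 x)) _.
by rewrite lerDr mulr_ge0 ?st_V_ge0 ?(ltW bet_gt0).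
Qed.

Lemma st_W_le_U x i : st_W i x <= st_U x / gam i.
Proof.
rewrite ler_pdivlMr ?gam_gt0// mulrC; apply: le_trans (st_term_le_U x i).
by rewrite lerDr mulr_ge0 ?dot_ge0 ?invr_ge0.
Qed.

Lemma st_e_le_U x i : dot (st_e i x) (st_e i x) <= 2 * st_U x.
Proof.
rewrite -ler_pdivrMl//; apply: le_trans (st_term_le_U x i).
by rewrite lerDl mulr_ge0 ?st_W_ge0// ltW ?gam_gt0.
Qed.

Section sublevel.
Context (r u : R).
Let P x := dot (st_v x) (st_v x) <= r /\ st_U x <= u.

Let bounded_on m k (f : state -> 'M[R]_(m, k)) := exists B : R, forall x, P x -> `|f x| <= B.

Let bounded_onD m k (f g : state -> 'M[R]_(m, k)) :
  bounded_on f -> bounded_on g -> bounded_on (fun x => f x + g x).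
Proof.
move=> [A hA] [B hB]; exists (A + B) => x Px; rewrite (le_trans (ler_normD _ _))//.
by rewrite lerD ?hA ?hB.
Qed.

Let bounded_onZ m k c (f : state -> 'M[R]_(m, k)) :
  bounded_on f -> bounded_on (fun x => c *: f x).
Proof.
by move=> [A hA]; exists (`|c| * A) => x Px; rewrite normrZ ler_wpM2l ?hA.
Qed.

Let bounded_onB m k (f g : state -> 'M[R]_(m, k)) :
  bounded_on f -> bounded_on g -> bounded_on (fun x => f x - g x).
Proof.
move=> bf bg; have [B hB] := bounded_onD bf (bounded_onZ (-1) bg).
by exists B => x Px; rewrite -scaleN1r hB.
Qed.

Let bounded_on_cst m k (A : 'M[R]_(m, k)) : bounded_on (fun=> A).
Proof. by exists `|A|. Qed.

Let bounded_onM m k h (f : state -> 'M[R]_(m, k)) (g : state -> 'M[R]_(k, h)) :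
  bounded_on f -> bounded_on g -> bounded_on (fun x => f x *m g x).
Proof.
move=> [A hA] [B hB]; exists (k%:R * (A * B)) => x Px.
rewrite (le_trans (norm_mulmx_le _ _))// ler_wpM2l// ler_pM ?hA ?hB//.
Qed.

Let bounded_on_ext m k (f g : state -> 'M[R]_(m, k)) :
  bounded_on f -> (forall x, f x = g x) -> bounded_on g.
Proof. by move=> [B hB] fg; exists B => x Px; rewrite -fg hB. Qed.

Let bounded_v : bounded_on st_v.
Proof. by exists (r + 1) => x [vr _]; exact: norm_le_dot1. Qed.

Let bounded_eta i : bounded_on (st_eta i).
Proof.
(* Chosen so that [d ^+ 2] dominates [4 * (u / bet)], as [energy_bound] requires, without a square
   root. *)
pose d := 4 * (u / bet) + 1.
have h : bounded_on (fun x => st_eta i x - st_v x).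
  exists (N.+1%:R * d) => x [_ Uu].
  have E0 := energy_ge0 E (st_v x) (st_eta ^~ x).
  have Vu : energy E (st_v x) (st_eta ^~ x) <= u / bet.
    apply: le_trans (_ : st_V x <= _).
      rewrite lerDl mulr_ge0 ?invr_ge0 ?(ltW mu2_gt0)//.
      by apply: sumr_ge0 => j _; rewrite mulr_ge0 ?invr_ge0 ?dot_ge0.
    by apply: le_trans (st_V_le_U x) _; rewrite ler_wpM2r ?invr_ge0 ?(ltW bet_gt0).
  have d0 : 0 <= d by rewrite /d; lra.
  by apply: (@energy_bound _ _ _ E Etree (st_v x) (st_eta ^~ x) d d0 _ i); rewrite /d; nra.
by apply: bounded_on_ext (bounded_onD h bounded_v) _ => x; rewrite subrK.
Qed.

Let bounded_om i : bounded_on (st_om i).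
Proof.
have h : bounded_on (fun x => st_om i x - om0).
  exists (2 * mu2 * (u / bet) + 1) => x [_ Uu]; apply: norm_le_dot1.
  have Vu : st_V x <= u / bet.
    by apply: le_trans (st_V_le_U x) _; rewrite ler_wpM2r ?invr_ge0 ?(ltW bet_gt0).
  rewrite -mulrA mulrCA -ler_pdivrMl// -ler_pdivrMl//; apply: le_trans Vu.
  apply: le_trans (_ : mu2^-1 * \sum_j (2^-1 * dot (st_om j x - om0) (st_om j x - om0)) <= _).
    rewrite mulrCA ler_wpM2l ?invr_ge0 ?(ltW mu2_gt0)//.
    apply: (@ler_sum_term _ _ (fun j => 2^-1 * dot (st_om j x - om0) (st_om j x - om0))) => j.
    by rewrite mulr_ge0 ?invr_ge0 ?dot_ge0.
  by rewrite lerDr energy_ge0.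
by apply: bounded_on_ext (bounded_onD h (bounded_on_cst om0)) _ => x; rewrite subrK.
Qed.

Let bounded_e i : bounded_on (st_e i).
Proof.
exists (2 * u + 1) => x [_ Uu]; apply: norm_le_dot1.
by apply: le_trans (st_e_le_U x i) _; rewrite ler_pM2l.
Qed.

Let st_W_le x i : P x -> st_W i x <= u / gam i.
Proof.
move=> [_ Uu]; apply: le_trans (st_W_le_U x i) _.
by rewrite ler_wpM2r ?invr_ge0 ?(ltW (gam_gt0 _)).
Qed.

Let bounded_s i : bounded_on (st_s i).
Proof.
have [a a0 ha] := Mpos i.
exists (2 * (u / gam i) / a + 1) => x Px; apply: norm_le_dot1.
have h1 := ha (st_q i x) (st_s i x); have := st_W_le i Px; rewrite /st_W => h2.
have h3 := dot_Lam_ge0 i (st_th i x - Theta i).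
rewrite ler_pdivlMr// mulrC; lra.
Qed.

Let bounded_th i : bounded_on (st_th i).
Proof.
have h : bounded_on (fun x => st_th i x - Theta i).
  exists ((\sum_k (Lam i k k)^-1) * (2 * (u / gam i)) + 1) => x Px; apply: norm_le_dot1.
  apply: le_trans (dot_Lam_le i _) _; rewrite ler_wpM2l//.
    by apply: sumr_ge0 => k _; rewrite invr_ge0 ltW.
  have [a a0 ha] := Mpos i.
  have h1 := ha (st_q i x) (st_s i x); have := st_W_le i Px; rewrite /st_W => h2.
  have h4 : 0 <= dot (st_s i x) (M i (st_q i x) *m st_s i x).
    by apply: le_trans h1; rewrite mulr_ge0 ?dot_ge0// ltW.
  lra.
by apply: bounded_on_ext (bounded_onD h (bounded_on_cst (Theta i))) _ => x; rewrite subrK.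
Qed.

Let bounded_q i : bounded_on (st_q i).
Proof.
have h := bounded_onD (bounded_e i) (bounded_onM (bounded_on_cst Cout) (bounded_eta i)).
by apply: bounded_on_ext h _ => x; rewrite subrK.
Qed.

Let bounded_Smat i : bounded_on (fun x => Smat (st_om i x)).
Proof.
by have [B hB] := bounded_om i; exists B => x Px; apply: le_trans (norm_Smat _) (hB x Px).
Qed.

Let bounded_qd i : bounded_on (st_qd i).
Proof.
have h : bounded_on (st_qdr i).
  apply: bounded_onB; last by apply: bounded_onZ; exact: bounded_e.
  apply: bounded_onM; last exact: bounded_eta.
  by apply: bounded_onM; [exact: bounded_on_cst|exact: bounded_Smat].
by apply: bounded_on_ext (bounded_onD (bounded_s i) h) _ => x; rewrite subrK.
Qed.

Let bounded_cols m (A : state -> 'M[R]_(m, N)) :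
  (forall i, bounded_on (fun x => col i (A x))) -> exists B : R, forall x, P x -> `|A x| <= B.
Proof.
move=> /(@choice _ _ _)[B hB]; exists (\sum_i `|B i|) => x Px.
apply/mx_norm_leP; split=> [|k i]; first by apply: sumr_ge0.
have -> : A x k i = col i (A x) k ord0 by rewrite mxE.
apply: le_trans (ler_mx_entry _ _ _) _; apply: le_trans (hB i x Px) _.
apply: le_trans (ler_norm _) _.
by apply: (@ler_sum_term _ _ (fun i => `|B i|)).
Qed.

(** [st_U] controls [eta - v], [om], [e], [s] and [th]. The bound on [v] then gives [eta]; [q] is
    recovered as [e + C eta], and [qd] as [s] plus the reference velocity, a function of quantities
    already bounded. *)
Lemma sublevel_bounded : exists B : R, forall x,
  dot (st_v x) (st_v x) <= r -> st_U x <= u -> `|x| <= B.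
Proof.
have [B1 h1] := bounded_v.
have [B2 h2] := bounded_cols (fun i => bounded_q i).
have [B3 h3] := bounded_cols (fun i => bounded_qd i).
have [B4 h4] := bounded_cols (fun i => bounded_eta i).
have [B5 h5] := bounded_cols (fun i => bounded_om i).
have [B6 h6] := bounded_cols (fun i => bounded_th i).
(* Absolute values, because a bound over an empty sublevel set may be negative. *)
exists (`|B1| + `|B2| + `|B3| + `|B4| + `|B5| + `|B6|) => x xr xu.
have Px : P x by [].
have {}h1 := h1 x Px; have {}h2 := h2 x Px; have {}h3 := h3 x Px.
have {}h4 := h4 x Px; have {}h5 := h5 x Px; have {}h6 := h6 x Px.
have := ler_norm B1; have := ler_norm B2; have := ler_norm B3.
have := ler_norm B4; have := ler_norm B5; have := ler_norm B6.
have := normr_ge0 B1; have := normr_ge0 B2; have := normr_ge0 B3.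
have := normr_ge0 B4; have := normr_ge0 B5; have := normr_ge0 B6.
move=> *; rewrite !prod_norm_leE; apply/andP; split; last by lra.
apply/andP; split; last by lra.
apply/andP; split; last by lra.
apply/andP; split; last by lra.
by apply/andP; split; lra.
Qed.

End sublevel.

(** * Continuity of the Lyapunov function and of its derivative *)

Let continuous_dot m (f g : state -> 'cV[R]_m) :
  continuous f -> continuous g -> continuous (fun x : state => dot (f x) (g x)).
Proof. by move=> fc gc x; apply: cvg_dot; [exact: fc|exact: gc]. Qed.

Let continuous_mulmxr m k (A : 'M[R]_(m, k)) (f : state -> 'cV[R]_k) :
  continuous f -> continuous (fun x : state => A *m f x).
Proof. by move=> fc x; apply: cvg_mulmxr; exact: fc. Qed.

Let continuousB_cst m (f : state -> 'cV[R]_m) (a : 'cV[R]_m) :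
  continuous f -> continuous (fun x : state => f x - a).
Proof. by move=> fc x; apply: cvgB; [exact: fc|exact: cvg_cst]. Qed.

Let continuous_Msum (f : 'I_N -> state -> R) (c : R) :
  (forall i, continuous (f i)) -> continuous (fun x : state => c * \sum_i f i x).
Proof.
move=> fc x; apply: cvgM; first exact: cvg_cst.
by apply: cvg_sumr => i; exact: fc.
Qed.

Let continuousMl (f : state -> R) (c : R) :
  continuous f -> continuous (fun x : state => c * f x).
Proof. by move=> fc x; apply: cvgM; [exact: cvg_cst|exact: fc]. Qed.

Lemma continuous_energy : continuous (fun x : state => energy E (st_v x) (st_eta ^~ x)).
Proof.
have hv i : continuous (fun x : state => st_eta i x - st_v x).
  by move=> x; apply: cvgB; [exact: continuous_st_eta|exact: continuous_st_v].
have hij i j : continuous (fun x : state => st_eta i x - st_eta j x).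
  by move=> x; apply: cvgB; exact: continuous_st_eta.
move=> x; apply: cvgD; last first.
  by apply: continuous_Msum => i; apply: continuousMl; exact: continuous_dot.
apply: continuous_Msum => i {}x; apply: cvg_sumr => j.
by apply: (continuousMl (f := fun x => dot (st_eta i x - st_eta j x) _)); exact: continuous_dot.
Qed.

Lemma continuous_st_V : continuous st_V.
Proof.
move=> x; apply: cvgD; first exact: continuous_energy.
apply: continuous_Msum => i; apply: continuousMl; apply: continuous_dot;
  by apply: continuousB_cst; exact: continuous_st_om.
Qed.

Lemma continuous_st_W i : continuous (st_W i).
Proof.
have hM : continuous (fun x : state => M i (st_q i x) *m st_s i x).
  move=> x; apply: cvg_mulmx; last exact: continuous_st_s.
  apply: (cvg_comp _ _ (@continuous_st_q i x)).
  exact: differentiable_continuous (Mdiff i _).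
have hth : continuous (fun x : state => st_th i x - Theta i).
  by apply: continuousB_cst; exact: continuous_st_th.
have h1 : continuous (fun x : state => dot (st_s i x) (M i (st_q i x) *m st_s i x)).
  exact: (continuous_dot (@continuous_st_s i) hM).
have h2 : continuous (fun x : state => dot (st_th i x - Theta i) (Lam i *m (st_th i x - Theta i))).
  exact: (continuous_dot hth (continuous_mulmxr hth)).
by move=> x; apply: cvgD; [exact: (@continuousMl _ 2^-1 h1 x)|exact: (@continuousMl _ 2^-1 h2 x)].
Qed.

Lemma continuous_st_U : continuous st_U.
Proof.
move=> x; apply: cvgD; first by apply: continuousMl; exact: continuous_st_V.
apply: cvg_sumr => i; apply: cvgD; apply: continuousMl; last exact: continuous_st_W.
by apply: continuous_dot; exact: continuous_st_e.
Qed.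

Lemma continuous_st_Ud : continuous st_Ud.
Proof.
move=> x; apply: cvgD.
  apply: (continuousMl (f := fun x => - (mu1 * \sum_i dot (st_ev i x) (st_ev i x)))) => {}x.
  apply: cvgN; apply: continuous_Msum => i.
  by apply: continuous_dot; exact: continuous_st_ev.
apply: cvg_sumr => i; apply: cvgD.
  apply: continuous_dot; first exact: continuous_st_e.
  move=> {}x; apply: cvgB; last first.
    by apply: cvgZ_cst; apply: cvg_mulmxr; exact: continuous_st_ev.
  by apply: cvgB; [exact: continuous_st_s|apply: cvgZ_cst; exact: continuous_st_e].
apply: (continuousMl (f := fun x => - dot (st_s i x) (K i *m st_s i x))) => {}x.
apply: cvgN; apply: (@continuous_dot _ (st_s i)); first exact: continuous_st_s.
by apply: continuous_mulmxr; exact: continuous_st_s.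
Qed.

(** * A priori bound and global existence *)

Lemma mean_value_state : mean_value_space state.
Proof.
by do 5?[apply: mean_value_space_prod; last exact: mean_value_space_mx];
  exact: mean_value_space_mx.
Qed.

(* Rescaling time by [chi] keeps [st_U] and [dot v v] monotone, hence the bound does not
   depend on [chi]; this is what allows the vector field to be cut off far away. *)
Lemma scaled_bounded x0 : exists B : R, forall (chi : R -> R) (X : R -> state),
  (forall t, 0 <= chi t) -> X 0 = x0 -> trajectory X (fun t => chi t *: field (X t)) ->
  forall t : R, 0 <= t -> `|X t| <= B.
Proof.
have [B hB] := sublevel_bounded (dot (st_v x0) (st_v x0)) (st_U x0).
exists B => chi X chi0 X0 [Xc Xd] t t0; apply: hB; rewrite -X0.
  have h : trajectory (fun t => 2^-1 * dot (st_v (X t)) (st_v (X t))) (fun=> 0).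
    split.
      have hc : continuous (fun x : state => 2^-1 * dot (st_v x) (st_v x)).
        by apply: continuousMl; apply: continuous_dot; exact: continuous_st_v.
      exact: (cvg_comp _ _ Xc (hc (X 0))).
    move=> s s0; apply: is_derive_eq (is_derive_sqdot (is_derive_st_v (Xd s s0))) _.
    by rewrite dotZr dot_skew ?mulr0//; exact: Smat_skew.
  have := trajectory_nincr h (fun _ _ => lexx 0) (lexx 0) t0.
  by rewrite ler_pM2l ?invr_gt0.
have h : trajectory (fun t => st_U (X t)) (fun t => chi t * st_Ud (X t)).
  split; first exact: (cvg_comp _ _ Xc (@continuous_st_U (X 0))).
  by move=> s s0; exact: (is_derive_st_U (Xd s s0)).
apply: (trajectory_nincr h) => // s s0; rewrite mulr_ge0_le0//.
apply: le_trans (st_Ud_le _) _; rewrite oppr_le0; apply: sumr_ge0 => i _.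
by rewrite !addr_ge0 ?mulr_ge0 ?dot_ge0 ?divr_ge0// ltW.
Qed.

Lemma field_trajectory_exists x0 : exists2 X : R -> state, X 0 = x0 & trajectory X (field \o X).
Proof.
have [B hB] := scaled_bounded x0.
(* The factor is 1 on the ball of radius [B] and 0 beyond [B + 1]; the field is bounded on the
   larger ball, so the product is bounded and continuous everywhere. *)
pose chi (x : state) : R := Num.min 1 (Num.max 0 (B + 1 - `|x|)).
have chi0 x : 0 <= chi x by rewrite /chi le_min ler01 le_max lexx.
have chi1 x : chi x <= 1 by rewrite /chi ge_min lexx.
have chi_cont : continuous chi.
  move=> x; apply: (@continuous_min _ _ (cst 1) (fun x => Num.max 0 (B + 1 - `|x|))).
    exact: cvg_cst.
  apply: (@continuous_max _ _ (cst 0) (fun x => B + 1 - `|x|)); first exact: cvg_cst.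
  by apply: cvgB; [exact: cvg_cst|apply: cvg_norm; exact: cvg_id].
have [L hL] := proper_space_bounded (B + 1) proper_state continuous_field.
have gc : continuous (fun x => chi x *: field x).
  by move=> x; apply: cvgZ; [exact: chi_cont|exact: continuous_field].
have gL x : `|chi x *: field x| <= `|L|.
  rewrite normrZ ger0_norm//; have [xB|xB] := leP `|x| (B + 1).
    rewrite -[leRHS]mul1r ler_pM//; apply: le_trans (hL x xB) (ler_norm _).
  have -> : chi x = 0 by rewrite /chi max_l ?min_r// subr_le0 ltW.
  by rewrite mul0r.
have [X [X0 Xt]] := peano_existence x0 proper_state gc gL.
(* The a priori bound is used with the time factor [chi \o X]; there is no circularity, as [B] was
   fixed before [chi]. *)
exists X => //; have XB := hB (chi \o X) X (fun t => chi0 _) X0 Xt.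
have [Xc Xd] := Xt; split=> // t t0; apply: is_derive_eq (Xd t t0) _ => /=.
have /= Xt' := XB t (ltW t0).
have -> : chi (X t) = 1; last by rewrite scale1r.
rewrite /chi min_l// le_max; apply/orP; right.
by rewrite lerBrDr addrC lerD2r.
Qed.

(** * Closed-loop solutions as trajectories of the field *)

Let cvg_pair2 (T : Type) (F : set_system T) {FF : Filter F} (U W : normedModType R)
    (f : T -> U) (g : T -> W) (a : U) (b : W) :
  f z @[z --> F] --> a -> g z @[z --> F] --> b -> (f z, g z) @[z --> F] --> (a, b).
Proof. exact: cvg_pair. Qed.

Lemma closed_loop_trajectory v q qd eta om th :
  closed_loop M Cm G Y Cout om0 E alpha mu1 mu2 K Lam v q qd eta om th ->
  let X t := mk_state (v t) (q ^~ t) (qd ^~ t) (eta ^~ t) (om ^~ t) (th ^~ t) in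
  trajectory X (field \o X).
Proof.
move=> [v0 [c0 hd]] X.
have Xv t : st_v (X t) = v t by [].
have Xq i t : st_q i (X t) = q i t by exact: (col_cols (q ^~ t)).
have Xqd i t : st_qd i (X t) = qd i t by exact: (col_cols (qd ^~ t)).
have Xeta i t : st_eta i (X t) = eta i t by exact: (col_cols (eta ^~ t)).
have Xom i t : st_om i (X t) = om i t by exact: (col_cols (om ^~ t)).
have Xth i t : st_th i (X t) = th i t by exact: (col_cols (th ^~ t)).
have cq i : q i t @[t --> 0^'+] --> q i 0 by have [] := c0 i.
have cqd i : qd i t @[t --> 0^'+] --> qd i 0 by have [] := c0 i.
have ceta i : eta i t @[t --> 0^'+] --> eta i 0 by have [] := c0 i.
have com i : om i t @[t --> 0^'+] --> om i 0 by have [] := c0 i.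
have cth i : th i t @[t --> 0^'+] --> th i 0 by have [] := c0 i.
split.
  exact: (cvg_pair2 (cvg_pair2 (cvg_pair2 (cvg_pair2 (cvg_pair2 v0 (cvg_cols cq))
    (cvg_cols cqd)) (cvg_cols ceta)) (cvg_cols com)) (cvg_cols cth)).
move=> t t0; have [dv di] := hd t t0.
have Xev i : st_ev i (X t) = \sum_(j < N.+1 | E j (lift ord0 i))
    (nodeval (v t) (fun k => eta k t) j - eta i t).
  by apply: eq_bigr => j _; rewrite /nodeval; case: unlift => [k|]; rewrite ?Xeta ?Xv.
have di' i : [/\ is_derive t 1 (q i) (st_qd i (X t)), is_derive t 1 (qd i) (st_acc i (X t)),
    is_derive t 1 (eta i) (st_etad i (X t)), is_derive t 1 (om i) (st_omd i (X t))
    & is_derive t 1 (th i) (st_thd i (X t))].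
  have := di i; rewrite /= -Xev -Xq -Xqd -Xeta -Xom -Xth => -[dq [acc [dqd eacc]] deta dom dth].
  split=> //; apply: is_derive_eq dqd _.
  have eacc' : M i (st_q i (X t)) *m acc + Cm i (st_q i (X t)) (st_qd i (X t)) *m st_qd i (X t) +
    G i (st_q i (X t)) = st_tau i (X t) by exact: eacc.
  by rewrite /st_acc -eacc' addrAC addrK addrK mulKmx ?unitmx_M.
have dq i : is_derive t 1 (q i) (st_qd i (X t)) by have [] := di' i.
have dqd i : is_derive t 1 (qd i) (st_acc i (X t)) by have [] := di' i.
have deta i : is_derive t 1 (eta i) (st_etad i (X t)) by have [] := di' i.
have dom i : is_derive t 1 (om i) (st_omd i (X t)) by have [] := di' i.
have dth i : is_derive t 1 (th i) (st_thd i (X t)) by have [] := di' i.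
have dvX : is_derive t 1 v (Smat om0 *m st_v (X t)) by [].
rewrite [(field \o X) t]/(field (X t)) /field.
exact: (is_derive_pair (is_derive_pair (is_derive_pair (is_derive_pair (is_derive_pair dvX
  (is_derive_cols dq)) (is_derive_cols dqd)) (is_derive_cols deta)) (is_derive_cols dom))
  (is_derive_cols dth)).
Qed.

Lemma trajectory_closed_loop X : trajectory X (field \o X) ->
  closed_loop M Cm G Y Cout om0 E alpha mu1 mu2 K Lam (fun t => st_v (X t))
    (fun i t => st_q i (X t)) (fun i t => st_qd i (X t)) (fun i t => st_eta i (X t))
    (fun i t => st_om i (X t)) (fun i t => st_th i (X t)).
Proof.
move=> [Xc Xd].
have Xd1 (t : R) : 0 < t -> is_derive t 1 X (1 *: field (X t)).
  by move=> t0; rewrite scale1r; exact: Xd.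
have sc (V : normedModType R) (f : R -> V) (t : R) df :
    is_derive t 1 f (1 *: df) -> is_derive t 1 f df by rewrite scale1r.
split; first exact: (cvg_comp _ _ Xc (@continuous_st_v (X 0))).
split.
  move=> i; split.
  - exact: (cvg_comp _ _ Xc (@continuous_st_q i (X 0))).
  - exact: (cvg_comp _ _ Xc (@continuous_st_qd i (X 0))).
  - exact: (cvg_comp _ _ Xc (@continuous_st_eta i (X 0))).
  - exact: (cvg_comp _ _ Xc (@continuous_st_om i (X 0))).
  - exact: (cvg_comp _ _ Xc (@continuous_st_th i (X 0))).
move=> t t0; split; first exact: (sc _ _ _ _ (is_derive_st_v (Xd1 t t0))).
move=> i; split.
- exact: (sc _ _ _ _ (is_derive_st_q (Xd1 t t0) i)).
- exists (st_acc i (X t)); split; first exact: (sc _ _ _ _ (is_derive_st_qd (Xd1 t t0) i)).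
  have h : M i (st_q i (X t)) *m st_acc i (X t) +
      Cm i (st_q i (X t)) (st_qd i (X t)) *m st_qd i (X t) + G i (st_q i (X t)) = st_tau i (X t).
    by rewrite /st_acc mulKVmx ?unitmx_M// addrAC subrK subrK.
  exact: h.
- exact: (sc _ _ _ _ (is_derive_st_eta (Xd1 t t0) i)).
- exact: (sc _ _ _ _ (is_derive_st_om (Xd1 t t0) i)).
- exact: (sc _ _ _ _ (is_derive_st_th (Xd1 t t0) i)).
Qed.

(** * Convergence of the errors along a solution *)

Section convergence.
Context (X : R -> state).
Hypothesis Xtraj : trajectory X (field \o X).

Let Xder (t : R) : 0 < t -> is_derive t 1 X (1 *: field (X t)).
Proof. by move=> t0; rewrite scale1r; exact: Xtraj.2. Qed.

Lemma field_trajectory_bounded : exists B : R, forall t : R, 0 <= t -> `|X t| <= B.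
Proof.
have [B hB] := scaled_bounded (X 0); exists B; apply: (hB (fun=> 1)) => //.
split; first exact: Xtraj.1.
by move=> t t0; exact: Xder.
Qed.

(** The source of every uniform continuity hypothesis: on the ball containing the solution the field
    is bounded, so [X] is Lipschitz, and [g] is uniformly continuous there. *)
Let X_unif (g : state -> R) (e : R) : continuous g -> 0 < e ->
  exists2 d : R, 0 < d & forall s t : R, 0 < s -> 0 < t -> `|s - t| < d ->
    `|g (X s) - g (X t)| < e.
Proof.
move=> gc e0; have [B hB] := field_trajectory_bounded.
have [L hL] := proper_space_bounded B proper_state continuous_field.
have XL := mean_value_state Xtraj (fun t t0 => hL _ (hB t (ltW t0))).
have L0 : 0 <= L by apply: le_trans (hL (X 0) (hB 0 (lexx 0))).
have [d d0 hd] := proper_space_unif_continuous B proper_state gc e0.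
have L1 : 0 < L + 1 by rewrite ltr_wpDl.
exists (d / (L + 1)); first by rewrite divr_gt0.
move=> s t s0 t0 st; apply: hd; first exact: hB (ltW s0).
move: st; rewrite ltr_pdivlMr// => st.
have hst : `|X s - X t| <= L * `|s - t|.
  have [h|h] := leP t s; first by rewrite (@ger0_norm _ (s - t)) ?subr_ge0// XL// ltW.
  rewrite distrC (distrC s t) (@ger0_norm _ (t - s)) ?subr_ge0 ?(ltW h)//.
  by rewrite XL// ltW.
apply: le_lt_trans hst _; apply: le_lt_trans st.
by rewrite mulrC ler_wpM2l// lerDl.
Qed.

(** [st_U] decreases and is nonnegative, hence converges. No second derivative is computed, as
    [st_Ud] is a continuous function of the state. *)
Let cvg_Ud : st_Ud (X t) @[t --> +oo] --> 0.
Proof.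
have h : trajectory (fun t => st_U (X t)) (fun t => st_Ud (X t)).
  split; first exact: (cvg_comp _ _ Xtraj.1 (@continuous_st_U (X 0))).
  by move=> s s0; apply: is_derive_eq (is_derive_st_U (Xder s0)) _; rewrite mul1r.
have Ud0 x : st_Ud x <= 0.
  apply: le_trans (st_Ud_le _) _; rewrite oppr_le0; apply: sumr_ge0 => i _.
  by rewrite !addr_ge0 ?mulr_ge0 ?dot_ge0 ?divr_ge0// ltW.
have hn := trajectory_nincr h (fun t _ => Ud0 (X t)).
have [|l0 hl0] := @nincr_bounded_cvg _ (fun t => st_U (X t)) 0 hn.
  by move=> t _; exact: st_U_ge0.
apply: barbalat h hl0 _ => e e0; exact: X_unif continuous_st_Ud e0.
Qed.

Let cvg_dissipation (f : state -> R) (c : R) : 0 < c -> (forall x, 0 <= f x) ->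
  (forall x, c * f x <= - st_Ud x) -> f (X t) @[t --> +oo] --> 0.
Proof.
move=> c0 f0 fU.
apply: (@squeeze_cvgr R (pinfty_nbhs R) _ R (fun=> 0) (fun t => c^-1 * - st_Ud (X t))
  (fun t => f (X t))).
- by apply: nearW => t; rewrite f0/= ler_pdivlMl.
- exact: cvg_cst.
- rewrite -[X in _ --> X](mulr0 c^-1); apply: cvgM; first exact: cvg_cst.
  by rewrite -oppr0; apply: cvgN; exact: cvg_Ud.
Qed.

Let term_le_Ud x i : alpha / 2 * dot (st_e i x) (st_e i x) + dot (st_s i x) (st_s i x) +
  dot (st_ev i x) (st_ev i x) <= - st_Ud x.
Proof.
rewrite lerNr; apply: le_trans (st_Ud_le x) _; rewrite lerN2.
apply: (@ler_sum_term _ _ (fun i => alpha / 2 * dot (st_e i x) (st_e i x) +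
  dot (st_s i x) (st_s i x) + dot (st_ev i x) (st_ev i x))) => j.
by rewrite !addr_ge0 ?mulr_ge0 ?dot_ge0 ?divr_ge0// ltW.
Qed.

Lemma cvg_st_e i : st_e i (X t) @[t --> +oo] --> (0 : 'cV[R]_n).
Proof.
apply: cvg0_dot; apply: (@cvg_dissipation (fun x => dot (st_e i x) (st_e i x)) (alpha / 2)).
- by rewrite divr_gt0.
- by move=> x; exact: dot_ge0.
- by move=> x; apply: le_trans (term_le_Ud x i); rewrite -addrA lerDl addr_ge0 ?dot_ge0.
Qed.

Lemma cvg_st_s i : st_s i (X t) @[t --> +oo] --> (0 : 'cV[R]_n).
Proof.
apply: cvg0_dot; apply: (@cvg_dissipation (fun x => dot (st_s i x) (st_s i x)) 1).
- by [].
- by move=> x; exact: dot_ge0.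
- move=> x; apply: le_trans (term_le_Ud x i); rewrite mul1r addrAC lerDr.
  by rewrite !addr_ge0 ?mulr_ge0 ?dot_ge0 ?divr_ge0// ltW.
Qed.

Lemma cvg_st_ev i : st_ev i (X t) @[t --> +oo] --> (0 : 'cV[R]_(l * 2)).
Proof.
apply: cvg0_dot; apply: (@cvg_dissipation (fun x => dot (st_ev i x) (st_ev i x)) 1).
- by [].
- by move=> x; exact: dot_ge0.
- move=> x; apply: le_trans (term_le_Ud x i); rewrite mul1r lerDr.
  by rewrite !addr_ge0 ?mulr_ge0 ?dot_ge0 ?divr_ge0// ltW.
Qed.

Lemma cvg_st_eta i : st_eta i (X t) - st_v (X t) @[t --> +oo] --> (0 : 'cV[R]_(l * 2)).
Proof.
have [B hB] := field_trajectory_bounded.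
have etaB j t : 0 <= t -> `|st_eta j (X t) - st_v (X t)| <= B + B.
  move=> /hB; rewrite !prod_norm_leE => /andP[/andP[/andP[/andP[/andP[hv _] _] he] _] _].
  rewrite (le_trans (ler_normB _ _))// lerD//.
  exact: le_trans (norm_col_le _ _) he.
have dot0 j : dot (st_ev j (X t)) (st_eta j (X t) - st_v (X t)) @[t --> +oo] --> 0.
  apply/cvgr0Pnorm_le => e e0.
  have B0 : 0 <= B + B by apply: le_trans (etaB j 0 (lexx 0)).
  (* The factor [(l * 2)%:R] comes from bounding the product by maximum norms, and [B + B] bounds
     [eta - v]; the summand 1 only makes the divisor positive. *)
  pose k := (l * 2)%:R * (B + B) + 1.
  have k0 : 0 < k by rewrite ltr_wpDl// mulr_ge0.
  have ek : 0 < e / k by rewrite divr_gt0.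
  have /cvgr0Pnorm_le/(_ _ ek) := cvg_st_ev j.
  move=> h; near=> t.
  have h1 : `|st_ev j (X t)| <= e / k by near: t; exact: h.
  apply: le_trans (ler_norm_dot _ _) _.
  have h2 : `|st_eta j (X t) - st_v (X t)| <= B + B by apply: etaB.
  apply: le_trans (_ : (l * 2)%:R * (e / k * (B + B)) <= _).
    by rewrite ler_wpM2l// ler_pM.
  rewrite mulrCA mulrAC ler_pdivrMr// ler_pM2l// /k lerDl//.
have E0 : energy E (st_v (X t)) (st_eta ^~ (X t)) @[t --> +oo] --> 0.
  have -> : (fun t => energy E (st_v (X t)) (st_eta ^~ (X t))) =
      (fun t => - 2^-1 * \sum_j dot (st_ev j (X t)) (st_eta j (X t) - st_v (X t))).
    apply/funext => t; have -> := energyE Eundirected (st_v (X t)) (st_eta ^~ (X t)).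
    by field.
  rewrite -[X in _ --> X](mulr0 (- 2^-1)); apply: cvgM; first exact: cvg_cst.
  have h : \sum_j dot (st_ev j (X t)) (st_eta j (X t) - st_v (X t)) @[t --> +oo] -->
      \sum_(j < N) (0 : R).
    by apply: cvg_sumr => j; exact: dot0.
  by rewrite big1_eq in h.
(* [energy_bound] loses a factor [N.+1] along the tree, so the target is [e / N.+1]; squaring it and
   dividing by 4 gives the energy threshold. *)
apply/cvgr0Pnorm_le => e e0; have eN : 0 < e / N.+1%:R by rewrite divr_gt0// ltr0n.
have e2 : 0 < (e / N.+1%:R) ^+ 2 / 4 by rewrite divr_gt0// exprn_gt0.
have /cvgr0Pnorm_le/(_ _ e2) h := E0.
near=> t.
have h1 : `|energy E (st_v (X t)) (st_eta ^~ (X t))| <= (e / N.+1%:R) ^+ 2 / 4.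
  by near: t; exact: h.
move: h1; rewrite ger0_norm ?energy_ge0// ler_pdivlMr// mulrC => h1.
have := energy_bound Etree (ltW eN) h1 i.
by rewrite mulrC divfK.
Unshelve. all: by end_near. Qed.

(** Barbalat's lemma is scalar, so it is applied to each entry of [eta_i - v], whose own limit is
    already known. *)
Lemma cvg_st_etad i :
  st_etad i (X t) - Smat om0 *m st_v (X t) @[t --> +oo] --> (0 : 'cV[R]_(l * 2)).
Proof.
apply/cvg_mxP => k j; rewrite mxE.
pose f t := (st_eta i (X t) - st_v (X t)) k j.
have hf : trajectory f (fun t => (st_etad i (X t) - Smat om0 *m st_v (X t)) k j).
  split.
    have hc : continuous (fun x : state => st_eta i x - st_v x).
      by move=> x; apply: cvgB; [exact: continuous_st_eta|exact: continuous_st_v].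
    by have /cvg_mxP := cvg_comp _ _ Xtraj.1 (hc _); exact.
  move=> t t0; have := is_deriveB (is_derive_st_eta (Xder t0) i) (is_derive_st_v (Xder t0)).
  by move=> /is_derive_mxP/(_ k j) h; apply: is_derive_eq h _; rewrite !scale1r.
have f0 : f t @[t --> +oo] --> 0.
  by have /cvg_mxP/(_ k j) := @cvg_st_eta i; rewrite mxE.
have hc : continuous (fun x : state => (st_etad i x - Smat om0 *m st_v x) k j).
  move=> x; have h : continuous (fun x : state => st_etad i x - Smat om0 *m st_v x).
    move=> y; apply: cvgB; first exact: continuous_st_etad.
    by apply: cvg_mulmxr; exact: continuous_st_v.
  by have /cvg_mxP := h x; exact.
by apply: barbalat hf f0 _ => e e0; exact: X_unif hc e0.
Qed.

Theorem tracking i : (st_q i (X t) - Cout *m st_v (X t) @[t --> +oo] --> (0 : 'cV[R]_n)) /\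
  (st_qd i (X t) - Cout *m (Smat om0 *m st_v (X t)) @[t --> +oo] --> (0 : 'cV[R]_n)).
Proof.
split.
  have -> : (fun t => st_q i (X t) - Cout *m st_v (X t)) =
      (fun t => st_e i (X t) + Cout *m (st_eta i (X t) - st_v (X t))).
    by apply/funext => t; rewrite /st_e mulmxBr addrA subrK.
  rewrite -[X in _ --> X](addr0 (0 : 'cV[R]_n)) -{2}(mulmx0 _ Cout).
  by apply: cvgD; [exact: cvg_st_e|apply: cvg_mulmxr; exact: cvg_st_eta].
(* Removing [mu1 *: st_ev] from [st_etad] leaves exactly [S(om_i) eta_i], the product occurring in
   the reference velocity, so every summand on the right is known to vanish. *)
have -> : (fun t => st_qd i (X t) - Cout *m (Smat om0 *m st_v (X t))) =
    (fun t => st_s i (X t) - alpha *: st_e i (X t) +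
      Cout *m (st_etad i (X t) - Smat om0 *m st_v (X t) - mu1 *: st_ev i (X t))).
  apply/funext => t; rewrite /st_s /st_qdr -/(st_e i _).
  have -> : st_etad i (X t) - Smat om0 *m st_v (X t) - mu1 *: st_ev i (X t) =
      Smat (st_om i (X t)) *m st_eta i (X t) - Smat om0 *m st_v (X t).
    by rewrite /st_etad addrAC addrK.
  rewrite mulmxBr !mulmxA.
  move: (_ *m st_eta i _) (_ *m st_v _) (st_qd i _) (alpha *: _) => a b d e.
  by apply/matrixP => r k; rewrite !mxE; ring.
have -> : (0 : 'cV[R]_n) = 0 - alpha *: 0 + Cout *m (0 - mu1 *: 0).
  by rewrite !scaler0 !subr0 mulmx0 addr0.
apply: cvgD.
  by apply: cvgB; [exact: cvg_st_s|apply: cvgZ_cst; exact: cvg_st_e].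
apply: cvg_mulmxr; apply: cvgB; first exact: cvg_st_etad.
by apply: cvgZ_cst; exact: cvg_st_ev.
Qed.

End convergence.

(** * Return to the original signals *)

Lemma closed_loop_existence v0 (q0 qd0 : 'I_N -> 'cV[R]_n) eta0 omi0 th0 :
  exists v q qd eta om th,
    closed_loop M Cm G Y Cout om0 E alpha mu1 mu2 K Lam v q qd eta om th /\
    v 0 = v0 /\
    forall i, [/\ q i 0 = q0 i, qd i 0 = qd0 i, eta i 0 = eta0 i,
                  om i 0 = omi0 i & th i 0 = th0 i].
Proof.
have [X X0 Xt] := field_trajectory_exists (mk_state v0 q0 qd0 eta0 omi0 th0).
exists (fun t => st_v (X t)), (fun i t => st_q i (X t)), (fun i t => st_qd i (X t)),
  (fun i t => st_eta i (X t)), (fun i t => st_om i (X t)), (fun i t => st_th i (X t)).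
split; first exact: trajectory_closed_loop.
by rewrite X0; split=> // i; split; exact: col_cols.
Qed.

Lemma closed_loop_tracking v q qd eta om th :
  closed_loop M Cm G Y Cout om0 E alpha mu1 mu2 K Lam v q qd eta om th ->
  forall i,
    [/\ bounded_pos (q i), bounded_pos (qd i), bounded_pos (eta i),
        bounded_pos (om i) & bounded_pos (th i)] /\
    (q i t - Cout *m v t @[t --> +oo] --> (0 : 'cV[R]_n)) /\
    (qd i t - Cout *m (Smat om0 *m v t) @[t --> +oo] --> (0 : 'cV[R]_n)).
Proof.
move=> /closed_loop_trajectory/=; set X := fun t => _ => Xt i.
have Xq t : st_q i (X t) = q i t by exact: (col_cols (q ^~ t)).
have Xqd t : st_qd i (X t) = qd i t by exact: (col_cols (qd ^~ t)).
have Xeta t : st_eta i (X t) = eta i t by exact: (col_cols (eta ^~ t)).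
have Xom t : st_om i (X t) = om i t by exact: (col_cols (om ^~ t)).
have Xth t : st_th i (X t) = th i t by exact: (col_cols (th ^~ t)).
split; last first.
  have [h1 h2] := tracking Xt i; split.
    by apply: cvg_trans h1; apply: near_eq_cvg; apply: nearW => t; rewrite /= Xq.
  by apply: cvg_trans h2; apply: near_eq_cvg; apply: nearW => t; rewrite /= Xqd.
have [B hB] := field_trajectory_bounded Xt.
have {}hB (t : R) : 0 <= t -> [/\ `|q i t| <= B, `|qd i t| <= B, `|eta i t| <= B,
    `|om i t| <= B & `|th i t| <= B].
  move=> /hB; rewrite !prod_norm_leE.
  move=> /andP[/andP[/andP[/andP[/andP[_ hq] hqd] heta] hom] hth].
  rewrite -Xq -Xqd -Xeta -Xom -Xth.
  by split; apply: le_trans (norm_col_le _ _) _.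
by split; exists B => t /hB[].
Qed.

End multi_agent_system.

Theorem theorem1 (R : realType) (N n p l : nat) (hl : (0 < l)%N)
  (M : 'I_N -> 'cV[R]_n -> 'M[R]_n)
  (Cm : 'I_N -> 'cV[R]_n -> 'cV[R]_n -> 'M[R]_n)
  (G : 'I_N -> 'cV[R]_n -> 'cV[R]_n)
  (Y : 'I_N -> 'cV[R]_n -> 'cV[R]_n -> 'cV[R]_n -> 'cV[R]_n -> 'M[R]_(n, p))
  (Theta : 'I_N -> 'cV[R]_p)
  (Cout : 'M[R]_(n, l * 2)) (om0 : 'cV[R]_l) (E : rel 'I_N.+1)
  (alpha mu1 mu2 : R) (K : 'I_N -> 'M[R]_n) (Lam : 'I_N -> 'M[R]_p)
  (* regularity of the model (implicit in the paper) *)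
  (hMd : forall i q, differentiable (M i) q)
  (hCc : forall i, continuous (fun z : 'cV[R]_n * 'cV[R]_n => Cm i z.1 z.2))
  (hGc : forall i, continuous (G i))
  (hYc : forall i, continuous (fun z : 'cV[R]_n * 'cV[R]_n * 'cV[R]_n * 'cV[R]_n =>
                                  Y i z.1.1.1 z.1.1.2 z.1.2 z.2))
  (* (P1) *)
  (hP1s : forall i q, (M i q)^T = M i q)
  (hP1p : forall i, exists2 c : R, 0 < c &
            forall q (x : 'cV[R]_n), c * (x^T *m x) ord0 ord0 <= (x^T *m M i q *m x) ord0 ord0)
  (* (P2) *)
  (hP2 : forall i q qd a' b,
      M i q *m a' + Cm i q qd *m b + G i q = Y i q qd a' b *m Theta i)
  (* (P3) *)
  (hP3 : forall i q qd,
      ('d (M i) q qd - 2%:R *: Cm i q qd)^T = - ('d (M i) q qd - 2%:R *: Cm i q qd))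
  (* leader *)
  (hom0 : forall k, 0 < om0 k ord0)
  (* graph *)
  (hE : has_spanning_tree E ord0)
  (hEu : forall i j : 'I_N, E (lift ord0 i) (lift ord0 j) = E (lift ord0 j) (lift ord0 i))
  (* gains *)
  (halpha : 0 < alpha) (hmu1 : 0 < mu1) (hmu2 : 0 < mu2)
  (hK : forall i, posdef (K i))
  (hLd : forall i, is_diag_mx (Lam i)) (hLp : forall i k, 0 < Lam i k k) :
  (forall (v0 : 'cV[R]_(l * 2)) (q0 qd0 : 'I_N -> 'cV[R]_n)
          (eta0 : 'I_N -> 'cV[R]_(l * 2)) (omi0 : 'I_N -> 'cV[R]_l)
          (th0 : 'I_N -> 'cV[R]_p),
     exists v q qd eta om th,
       closed_loop M Cm G Y Cout om0 E alpha mu1 mu2 K Lam v q qd eta om th /\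
       v 0 = v0 /\
       forall i, [/\ q i 0 = q0 i, qd i 0 = qd0 i, eta i 0 = eta0 i,
                     om i 0 = omi0 i & th i 0 = th0 i]) /\
  (forall v q qd eta om th,
     closed_loop M Cm G Y Cout om0 E alpha mu1 mu2 K Lam v q qd eta om th ->
     forall i,
       [/\ bounded_pos (q i), bounded_pos (qd i), bounded_pos (eta i),
           bounded_pos (om i) & bounded_pos (th i)] /\
       (q i t - Cout *m v t @[t --> +oo] --> (0 : 'cV[R]_n)) /\
       (qd i t - Cout *m (Smat om0 *m v t) @[t --> +oo] --> (0 : 'cV[R]_n))).
Proof.
have Mpos i : exists2 c : R, 0 < c &
    forall q (x : 'cV[R]_n), c * dot x x <= dot x (M i q *m x).
  have [c c0 hc] := hP1p i; exists c => // q x.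
  by have := hc q x; rewrite dotE -mulmxA dotE.
(* A plain conjunction in place of [exists2], so that [choice] yields one function [kap] of
   coercivity constants, on which the weights [gam] depend. *)
have Kpos i : exists k : R, 0 < k /\ forall y : 'cV[R]_n, k * dot y y <= dot y (K i *m y).
  by have [k k0 hk] := posdef_coercive (hK i); exists k.
have [kap hkap] := choice Kpos.
have [cC cC0 hC] := dot_mulmx_bound Cout.
split=> [v0 q0 qd0 eta0 omi0 th0|v q qd eta om th].
  exact: (closed_loop_existence om0 hMd hCc hGc hYc Mpos hEu hmu2 hP1s hP2 hP3 hLd hLp hE
    halpha hmu1 (fun i => (hkap i).1) (fun i => (hkap i).2) cC0 hC).
exact: (closed_loop_tracking hMd hCc hGc hYc Mpos hEu hmu2 hP1s hP2 hP3 hLd hLp hE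
  halpha hmu1 (fun i => (hkap i).1) (fun i => (hkap i).2) cC0 hC).
Qed.
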